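(* For $n\ge3$, the natural morphism of $S^{\dagger\dagger}$-algebras $BMW_n^{\dagger\dagger}\to F_n\otimes_A S^{\dagger\dagger}$, $s_i\mapsto s_i$, induces an isomorphism after tensoring over $S^{\dagger\dagger}$ with $S^{\dagger\dagger}[(x+2a)^{-1}]$.
   Context: $R=\mathbb{Q}[a,b,c,(abc)^{-1}]$, $x=b+c$, $y=bc$, $S=R[x^{-1}]$, $S^{\dagger\dagger}=S/(a^2-1,y-1)$. $B_n$ is the braid group with Artin generators $s_i$; $H_n=RB_n/((s_i-a)(s_i-b)(s_i-c))$. $\widetilde{BMW}_n$ is the quotient of $H_n$ by the two-sided ideal generated by $$\mathcal{R}_i=-y\,s_is_{i+1}^{-1}s_i+y^2s_{i+1}^{-1}s_is_{i+1}^{-1}-s_is_{i+1}s_i-xy^2s_{i+1}^{-2}+x\,s_i^2+y^3s_{i+1}^{-1}s_i^{-1}s_{i+1}^{-1},\quad 1\le i\le n-2,$$ and $BMW_n^{\dagger\dagger}=\widetilde{BMW}_n\otimes_R S^{\dagger\dagger}$. $A=\mathbb{Q}[a,x,x^{-1}]/(a^2-1)$, mapped to $S^{\dagger\dagger}$ by $a\mapsto a$, $x\mapsto b+c$. For $n\ge3$, $F_n$ is the unital $A$-algebra with generators $s_1,\dots,s_{n-1}$ (invertible by the cubic relation), $e_1,\dots,e_{n-1}$, $C$ and relations (for all meaningful indices): $s_is_{i+1}s_i=s_{i+1}s_is_{i+1}$; $s_is_j=s_js_i$ for $|i-j|\ge2$; $(s_i-a)(s_i^2-xs_i+1)=0$;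 $e_i=a\left(\frac{s_i^{-1}+s_i}{x}-1\right)$; $s_ie_i=ae_i$; $e_is_{i\pm1}e_i=e_i+C$; $e_is_{i\pm1}^{-1}e_i=e_i+C$; $s_iC=Cs_i=aC$. *)

(* Defs.v *)
From HB Require Import structures.
From mathcomp Require Import all_boot all_order all_algebra.
From mathcomp Require Import finmap mpoly monalg.
From mathcomp Require Import ring boolp.

Set Implicit Arguments.
Unset Strict Implicit.
Unset Printing Implicit Defensive.

Import GRing.Theory.

Local Open Scope ring_scope.
Local Open Scope quotient_scope.

(* ------------------------------------------------------------------------ *)
(* Unital associative algebras over a commutative ring K: rings equipped    *)
(* with a central ring morphism k |-> k%:K from K. MathComp's algType       *)
(* demands 1 != 0, which has no reason to be assumed for an algebra given   *)
(* by generators and relations.                                             *)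

HB.mixin Record PzRing_isPzAlgebra (K : comPzRingType) V of GRing.PzRing V := {
  pz_in_alg : {rmorphism K -> V};
  pz_in_algC : forall k (u : V), pz_in_alg k * u = u * pz_in_alg k
}.

#[short(type="pzAlgType")]
HB.structure Definition PzAlgebra (K : comPzRingType) :=
  {V of GRing.PzRing V & PzRing_isPzAlgebra K V}.

Notation "k %:K" := (pz_in_alg k) (at level 1, left associativity,
  format "k %:K") : ring_scope.

Lemma pzalg_mulACA (K : comPzRingType) (E : pzAlgType K) (a b : K) (u v : E) :
  (a%:K * u) * (b%:K * v) = (a * b)%:K * (u * v).
Proof. by rewrite rmorphM -!mulrA [u * (_ * _)]mulrA -pz_in_algC -mulrA. Qed.

HB.mixin Record isPzAlgMorphism (K : comPzRingType) (A B : pzAlgType K)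
    (f : A -> B) := {
  pzalg_morphK : forall k : K, f k%:K = k%:K
}.

HB.structure Definition PzAlgMorphism (K : comPzRingType) (A B : pzAlgType K) :=
  {f of @GRing.RMorphism A B f & @isPzAlgMorphism K A B f}.

Notation "{ 'pzalg' A '->' B }" := (PzAlgMorphism.type A B)
  (at level 0, A at level 98, B at level 99, format "{ 'pzalg'  A  ->  B }")
  : type_scope.

(* ------------------------------------------------------------------------ *)
(* Quotient of a ring by the two-sided ideal generated by a set X.          *)
(* MathComp's {ideal_quot _} covers only proper ideals of commutative       *)
(* rings; no such restriction is wanted here, hence the pzRingType's.       *)

Inductive ideal_gen (E : pzRingType) (X : E -> Prop) : E -> Prop :=
| ideal_gen_in u : X u -> ideal_gen X u
| ideal_gen0 : ideal_gen X 0
| ideal_genB u v : ideal_gen X u -> ideal_gen X v -> ideal_gen X (u - v)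
| ideal_genM l u r : ideal_gen X u -> ideal_gen X (l * u * r).

Definition ideal_pred (E : pzRingType) (X : E -> Prop) : {pred E} :=
  fun u => `[< ideal_gen X u >].

Section IdealPred.
Context (E : pzRingType) (X : E -> Prop).

Fact ideal_pred_zmod : zmod_closed (ideal_pred X).
Proof.
split; first exact/asboolP/ideal_gen0.
by move=> u v /asboolP hu /asboolP hv; apply/asboolP/ideal_genB.
Qed.
HB.instance Definition _ := GRing.isZmodClosed.Build E (ideal_pred X)
  ideal_pred_zmod.

Lemma ideal_predMl l u : u \in ideal_pred X -> l * u \in ideal_pred X.
Proof.
move=> /asboolP hu; apply/asboolP.
by rewrite -[l * u]mulr1; apply: ideal_genM.
Qed.

Lemma ideal_predMr r u : u \in ideal_pred X -> u * r \in ideal_pred X.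
Proof.
move=> /asboolP hu; apply/asboolP.
by rewrite -[u]mul1r; apply: ideal_genM.
Qed.
End IdealPred.

Definition ringQuot (E : pzRingType) (X : E -> Prop) : Type :=
  Quotient.quot (ideal_pred X).

Section RingQuot.
Context (E : pzRingType) (X : E -> Prop).
Local Notation Q := (ringQuot X).

HB.instance Definition _ := GRing.Zmodule.on Q.
HB.instance Definition _ := EqQuotient.on Q.

Definition rq (u : E) : Q := \pi_Q u.

Lemma rqP u v : reflect (rq u = rq v) (u - v \in ideal_pred X).
Proof. by rewrite /rq Quotient.idealrBE; apply: eqP. Qed.

Lemma rq_repr z : rq (repr z) = z. Proof. exact: reprK. Qed.

Lemma rqW (P : Q -> Prop) : (forall u, P (rq u)) -> forall z, P z.
Proof. by move=> h z; rewrite -[z]rq_repr. Qed.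

Fact rq_zmod : zmod_morphism rq.
Proof. by move=> u v; rewrite /rq !piE. Qed.
HB.instance Definition _ := GRing.isZmodMorphism.Build E Q rq rq_zmod.

Lemma rq_rel u : X u -> rq u = 0.
Proof.
move=> hu; rewrite -(raddf0 rq); apply/rqP; rewrite subr0.
exact/asboolP/ideal_gen_in.
Qed.

Lemma rq_repr_sub u : repr (rq u) - u \in ideal_pred X.
Proof. by apply/rqP; rewrite rq_repr. Qed.

Definition rq_mul (z w : Q) : Q := rq (repr z * repr w).

Lemma rq_mulE u v : rq_mul (rq u) (rq v) = rq (u * v).
Proof.
apply/rqP.
have -> : repr (rq u) * repr (rq v) - u * v
        = (repr (rq u) - u) * repr (rq v) + u * (repr (rq v) - v).
  by rewrite mulrBl mulrBr addrA subrK.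
apply: rpredD; first exact/ideal_predMr/rq_repr_sub.
exact/ideal_predMl/rq_repr_sub.
Qed.

Fact rq_mulA : associative rq_mul.
Proof.
by elim/rqW=> u; elim/rqW=> v; elim/rqW=> w; rewrite !rq_mulE mulrA.
Qed.
Fact rq_mul1 : left_id (rq 1) rq_mul.
Proof. by elim/rqW=> u; rewrite rq_mulE mul1r. Qed.
Fact rq_mul1r : right_id (rq 1) rq_mul.
Proof. by elim/rqW=> u; rewrite rq_mulE mulr1. Qed.
Fact rq_mulDl : left_distributive rq_mul +%R.
Proof.
elim/rqW=> u; elim/rqW=> v; elim/rqW=> w.
by rewrite -raddfD !rq_mulE -raddfD mulrDl.
Qed.
Fact rq_mulDr : right_distributive rq_mul +%R.
Proof.
elim/rqW=> u; elim/rqW=> v; elim/rqW=> w.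
by rewrite -raddfD !rq_mulE -raddfD mulrDr.
Qed.
HB.instance Definition _ := GRing.Zmodule_isPzRing.Build Q
  rq_mulA rq_mul1 rq_mul1r rq_mulDl rq_mulDr.

Fact rq_monoid : monoid_morphism rq.
Proof. by split=> // u v; rewrite -rq_mulE. Qed.
HB.instance Definition _ := GRing.isMonoidMorphism.Build E Q rq rq_monoid.

Section Lift.
Context (T : pzRingType) (g : {rmorphism E -> T}).

Definition rq_lift (_ : forall u, X u -> g u = 0) (z : Q) : T := g (repr z).

Hypothesis gX : forall u, X u -> g u = 0.

Lemma rq_liftE u : rq_lift gX (rq u) = g u.
Proof.
apply/eqP; rewrite -subr_eq0 /rq_lift -rmorphB; apply/eqP.
have /asboolP := rq_repr_sub u; move: (_ - u) => w; elim=> {w}.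
- exact: gX.
- exact: rmorph0.
- by move=> v w _ hv _ hw; rewrite rmorphB hv hw subrr.
- by move=> l w r _ hw; rewrite !rmorphM hw mulr0 mul0r.
Qed.

Fact rq_lift_zmod : zmod_morphism (rq_lift gX).
Proof.
by elim/rqW=> u; elim/rqW=> v; rewrite -rmorphB !rq_liftE rmorphB.
Qed.
HB.instance Definition _ := GRing.isZmodMorphism.Build Q T (rq_lift gX)
  rq_lift_zmod.

Fact rq_lift_monoid : monoid_morphism (rq_lift gX).
Proof.
split; first by rewrite -(rmorph1 rq) rq_liftE rmorph1.
by elim/rqW=> u; elim/rqW=> v; rewrite -rmorphM !rq_liftE rmorphM.
Qed.
HB.instance Definition _ := GRing.isMonoidMorphism.Build Q T (rq_lift gX)
  rq_lift_monoid.
End Lift.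
End RingQuot.

Section ComRingQuot.
Context (E : comPzRingType) (X : E -> Prop).

Fact rq_mulC : @commutative (ringQuot X) _ *%R.
Proof. by elim/rqW=> u; elim/rqW=> v; rewrite -!rmorphM mulrC. Qed.
HB.instance Definition _ :=
  GRing.PzRing_hasCommutativeMul.Build (ringQuot X) rq_mulC.
End ComRingQuot.

Section AlgQuot.
Context (K : comPzRingType) (E : pzAlgType K) (X : E -> Prop).
Local Notation Q := (ringQuot X).

Definition rq_in_alg : {rmorphism K -> Q} := rq X \o (@pz_in_alg K E).

Fact rq_in_algC k (z : Q) : rq_in_alg k * z = z * rq_in_alg k.
Proof. by elim/rqW: z => u; rewrite /= -!rmorphM pz_in_algC. Qed.
HB.instance Definition _ := PzRing_isPzAlgebra.Build K Q rq_in_algC.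

Fact rq_morphK (k : K) : rq X k%:K = k%:K.
Proof. by []. Qed.
HB.instance Definition _ := isPzAlgMorphism.Build K E Q (rq X) rq_morphK.

Section Lift.
Context (T : pzAlgType K) (g : {pzalg E -> T}).
Hypothesis gX : forall u, X u -> g u = 0.

Fact rq_lift_morphK (k : K) : rq_lift gX k%:K = k%:K.
Proof. exact: etrans (rq_liftE gX _) (pzalg_morphK (s := g) k). Qed.
HB.instance Definition _ := isPzAlgMorphism.Build K Q T (rq_lift gX)
  rq_lift_morphK.
End Lift.
End AlgQuot.

(* ------------------------------------------------------------------------ *)
(* Localization S[u^-1]: (r, k) stands for r / u^k.                         *)

Section Localization.
Context (S : comPzRingType) (u : S).

Definition loc_eq (p q : S * nat) : bool :=
  `[< exists m, u ^+ m * (u ^+ q.2 * p.1) = u ^+ m * (u ^+ p.2 * q.1) >].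

Fact loc_eq_equiv : equiv_class_of loc_eq.
Proof.
split=> [p|p q|q p r]; first by apply/asboolP; exists 0%N.
- by apply/asboolP/asboolP=> -[m e]; exists m.
- move=> /asboolP[m e] /asboolP[k e']; apply/asboolP.
  exists (m + k + q.2)%N.
  transitivity (u ^+ k * u ^+ r.2 * (u ^+ m * (u ^+ q.2 * p.1))).
    by rewrite !exprD; ring.
  rewrite e.
  transitivity (u ^+ m * u ^+ p.2 * (u ^+ k * (u ^+ r.2 * q.1))); first by ring.
  by rewrite e' !exprD; ring.
Qed.
Canonical loc_equiv := EquivRelPack loc_eq_equiv.
Canonical loc_encModRel := defaultEncModRel loc_eq.

Definition loc : Type := {eq_quot loc_eq}.
HB.instance Definition _ := EqQuotient.on loc.
HB.instance Definition _ := Choice.on loc.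

Definition frac (r : S) (k : nat) : loc := \pi_loc (r, k).

Lemma fracP r k r' k' : frac r k = frac r' k' <->
  exists m, u ^+ m * (u ^+ k' * r) = u ^+ m * (u ^+ k * r').
Proof.
rewrite /frac; split=> [/eqP|h]; first by rewrite piE => /asboolP.
by apply/eqP; rewrite piE; apply/asboolP.
Qed.

Lemma locW (P : loc -> Prop) : (forall r k, P (frac r k)) -> forall z, P z.
Proof. by move=> h z; rewrite -[z]reprK; case: (repr z). Qed.

Lemma repr_frac r k :
  exists m, u ^+ m * (u ^+ k * (repr (frac r k)).1)
          = u ^+ m * (u ^+ (repr (frac r k)).2 * r).
Proof. by apply/fracP; rewrite /frac -surjective_pairing reprK. Qed.

Definition loc_add (z w : loc) : loc :=
  frac (u ^+ (repr w).2 * (repr z).1 + u ^+ (repr z).2 * (repr w).1)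
       ((repr z).2 + (repr w).2).
Definition loc_opp (z : loc) : loc := frac (- (repr z).1) (repr z).2.
Definition loc_mul (z w : loc) : loc :=
  frac ((repr z).1 * (repr w).1) ((repr z).2 + (repr w).2).

Lemma loc_addE r k r' k' : loc_add (frac r k) (frac r' k') =
  frac (u ^+ k' * r + u ^+ k * r') (k + k').
Proof.
rewrite /loc_add; apply/fracP.
have [m] := repr_frac r k; have [m'] := repr_frac r' k'.
case: (repr (frac r k)) => p i /=; case: (repr (frac r' k')) => p' i' /= e' e.
exists (m + m')%N; rewrite !exprD.
transitivity (u ^+ k' * u ^+ i' * u ^+ m' * (u ^+ m * (u ^+ k * p))
            + u ^+ k * u ^+ i * u ^+ m * (u ^+ m' * (u ^+ k' * p'))).
  by ring.
by rewrite e e'; ring.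
Qed.

Lemma loc_oppE r k : loc_opp (frac r k) = frac (- r) k.
Proof.
rewrite /loc_opp; apply/fracP; have [m] := repr_frac r k.
by case: (repr (frac r k)) => p i /= e; exists m; rewrite !mulrN e.
Qed.

Lemma loc_mulE r k r' k' :
  loc_mul (frac r k) (frac r' k') = frac (r * r') (k + k').
Proof.
rewrite /loc_mul; apply/fracP.
have [m] := repr_frac r k; have [m'] := repr_frac r' k'.
case: (repr (frac r k)) => p i /=; case: (repr (frac r' k')) => p' i' /= e' e.
exists (m + m')%N; rewrite !exprD.
transitivity ((u ^+ m * (u ^+ k * p)) * (u ^+ m' * (u ^+ k' * p'))); first by ring.
by rewrite e e'; ring.
Qed.

Fact loc_addA : associative loc_add.
Proof.
elim/locW=> r k; elim/locW=> r' k'; elim/locW=> r2 k2.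
rewrite !loc_addE; apply/fracP; exists 0%N; rewrite !exprD; ring.
Qed.
Fact loc_addC : commutative loc_add.
Proof.
elim/locW=> r k; elim/locW=> r' k'.
by rewrite !loc_addE addrC addnC.
Qed.
Fact loc_add0 : left_id (frac 0 0) loc_add.
Proof.
elim/locW=> r k; rewrite !loc_addE add0n.
by rewrite mulr0 add0r expr0 mul1r.
Qed.
Fact loc_addN : left_inverse (frac 0 0) loc_opp loc_add.
Proof.
elim/locW=> r k; rewrite loc_oppE loc_addE; apply/fracP; exists 0%N.
rewrite !exprD; ring.
Qed.
HB.instance Definition _ := GRing.isZmodule.Build loc
  loc_addA loc_addC loc_add0 loc_addN.

Fact loc_mulA : associative loc_mul.
Proof.
elim/locW=> r k; elim/locW=> r' k'; elim/locW=> r2 k2.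
by rewrite !loc_mulE mulrA addnA.
Qed.
Fact loc_mulC : commutative loc_mul.
Proof.
by elim/locW=> r k; elim/locW=> r' k'; rewrite !loc_mulE mulrC addnC.
Qed.
Fact loc_mul1 : left_id (frac 1 0) loc_mul.
Proof. by elim/locW=> r k; rewrite !loc_mulE mul1r add0n. Qed.
Fact loc_mulDl : left_distributive loc_mul +%R.
Proof.
elim/locW=> r k; elim/locW=> r' k'; elim/locW=> r2 k2.
rewrite [_ + _]loc_addE !loc_mulE [RHS]loc_addE; apply/fracP; exists 0%N.
rewrite !exprD; ring.
Qed.
HB.instance Definition _ := GRing.Zmodule_isComPzRing.Build loc
  loc_mulA loc_mulC loc_mul1 loc_mulDl.

Definition loc_in (r : S) : loc := frac r 0.
Definition loc_inv : loc := frac 1 1.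

Fact loc_in_zmod : zmod_morphism loc_in.
Proof.
move=> r r'; rewrite /loc_in [- frac _ _]loc_oppE [RHS]loc_addE.
by rewrite !expr0 !mul1r.
Qed.
HB.instance Definition _ := GRing.isZmodMorphism.Build S loc loc_in loc_in_zmod.
Fact loc_in_monoid : monoid_morphism loc_in.
Proof. by split=> // r r'; rewrite [RHS]loc_mulE. Qed.
HB.instance Definition _ := GRing.isMonoidMorphism.Build S loc loc_in
  loc_in_monoid.

Lemma loc_inK : loc_in u * loc_inv = 1.
Proof.
rewrite [LHS]loc_mulE; apply/fracP; exists 0%N.
by rewrite !expr0 add0n expr1 !mul1r mulr1.
Qed.

Lemma fracE r k : frac r k = loc_in r * loc_inv ^+ k.
Proof.
elim: k => [|k IHk]; first by rewrite expr0 mulr1.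
by rewrite exprSr mulrA -IHk [RHS]loc_mulE mulr1 addn1.
Qed.

Section Lift.
Context (T : comPzRingType) (g : {rmorphism S -> T}) (v : T).

Definition loc_lift (_ : g u * v = 1) (z : loc) : T :=
  g (repr z).1 * v ^+ (repr z).2.

Hypothesis guv : g u * v = 1.

Lemma loc_liftE r k : loc_lift guv (frac r k) = g r * v ^+ k.
Proof.
rewrite /loc_lift; have [m] := repr_frac r k.
case: (repr (frac r k)) => p i /= e.
have gv j : g u ^+ j * v ^+ j = 1 by rewrite -exprMn guv expr1n.
have {e} := congr1 g e; rewrite !rmorphM !rmorphXn => e.
transitivity (g u ^+ m * v ^+ m * (g u ^+ k * v ^+ k) * (g p * v ^+ i)).
  by rewrite !gv !mul1r.
transitivity (v ^+ m * v ^+ k * v ^+ i * (g u ^+ m * (g u ^+ k * g p))).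
  by ring.
rewrite e.
transitivity (g u ^+ m * v ^+ m * (g u ^+ i * v ^+ i) * (g r * v ^+ k)).
  by ring.
by rewrite !gv !mul1r.
Qed.

Lemma loc_lift_in r : loc_lift guv (loc_in r) = g r.
Proof. by rewrite loc_liftE expr0 mulr1. Qed.

Fact loc_lift_zmod : zmod_morphism (loc_lift guv).
Proof.
elim/locW=> r k; elim/locW=> r' k'.
rewrite [- frac _ _]loc_oppE [_ + _]loc_addE !loc_liftE.
have gv j : g u ^+ j * v ^+ j = 1 by rewrite -exprMn guv expr1n.
rewrite rmorphD !rmorphM !rmorphXn rmorphN exprD.
transitivity (g u ^+ k' * v ^+ k' * (g r * v ^+ k)
            - g u ^+ k * v ^+ k * (g r' * v ^+ k')); first by ring.
by rewrite !gv !mul1r.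
Qed.
HB.instance Definition _ := GRing.isZmodMorphism.Build loc T (loc_lift guv)
  loc_lift_zmod.
Fact loc_lift_monoid : monoid_morphism (loc_lift guv).
Proof.
split; first by rewrite loc_lift_in rmorph1.
elim/locW=> r k; elim/locW=> r' k'.
by rewrite [_ * _]loc_mulE !loc_liftE rmorphM exprD; ring.
Qed.
HB.instance Definition _ := GRing.isMonoidMorphism.Build loc T (loc_lift guv)
  loc_lift_monoid.
End Lift.
End Localization.

(* ------------------------------------------------------------------------ *)
(* Monoid algebra K[M]: finitely supported functions M -> K, with the       *)
(* convolution product. For M a group this is the group algebra, for M the  *)
(* free monoid on X it is the free associative algebra on X.                *)

Section MonoidAlgebra.
Context (K : comPzRingType) (M : monoidType).
Local Open Scope fset_scope.
Local Open Scope ring_scope.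

Definition monAlg : Type := {malg K[M]}.
HB.instance Definition _ := GRing.Zmodule.on monAlg.

Implicit Types (f g : monAlg) (k l : M).

Definition ma_in (k : M) : monAlg := << (1 : K) *g k >>.

Definition ma_mul f g : monAlg :=
  \sum_(k <- msupp f) \sum_(l <- msupp g)
    << mcoeff k f * mcoeff l g *g (k * l)%g >>.

Lemma ma_mulw (d d' : {fset M}) f g : msupp f `<=` d -> msupp g `<=` d' ->
  ma_mul f g = \sum_(k <- d) \sum_(l <- d')
    << mcoeff k f * mcoeff l g *g (k * l)%g >>.
Proof.
move=> le_d le_d'; rewrite /ma_mul (big_fset_incl _ le_d) /=.
  apply/eq_bigr=> k _; apply/big_fset_incl => // l _ /mcoeff_outdom ->.
  by rewrite mulr0 monalgU0.
move=> k _ /mcoeff_outdom fk.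
by rewrite big1 => // l _; rewrite fk mul0r monalgU0.
Qed.

Fact ma_mulDl : left_distributive ma_mul +%R.
Proof.
move=> f1 f2 g.
rewrite (ma_mulw (fsubsetUl (msupp f1) (msupp f2)) (fsubset_refl (msupp g))).
rewrite (ma_mulw (fsubsetUr (msupp f1) (msupp f2)) (fsubset_refl (msupp g))).
rewrite (ma_mulw (msuppD_le f1 f2) (fsubset_refl (msupp g))).
rewrite -big_split /=; apply/eq_bigr=> k _.
rewrite -big_split /=; apply/eq_bigr=> l _.
by rewrite mcoeffD mulrDl monalgUD.
Qed.

Fact ma_mulDr : right_distributive ma_mul +%R.
Proof.
move=> g f1 f2.
rewrite (ma_mulw (fsubset_refl (msupp g)) (fsubsetUl (msupp f1) (msupp f2))).
rewrite (ma_mulw (fsubset_refl (msupp g)) (fsubsetUr (msupp f1) (msupp f2))).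
rewrite (ma_mulw (fsubset_refl (msupp g)) (msuppD_le f1 f2)).
rewrite -big_split /=; apply/eq_bigr=> k _.
rewrite -big_split /=; apply/eq_bigr=> l _.
by rewrite mcoeffD mulrDr monalgUD.
Qed.

Lemma ma_mulUU c c' k k' :
  ma_mul << c *g k >> << c' *g k' >> = << c * c' *g (k * k')%g >>.
Proof. by rewrite (ma_mulw msuppU_le msuppU_le) !big_seq_fset1 !mcoeffUU. Qed.

Lemma ma_ind (P : monAlg -> Prop) :
  P 0 -> (forall f g, P f -> P g -> P (f + g)) ->
  (forall c k, P << c *g k >>) -> forall f, P f.
Proof.
by move=> P0 PD PU f; rewrite [f]monalgE; elim/big_ind: _ => // k _; apply: PU.
Qed.

Fact ma_mul0l : left_zero 0 ma_mul.
Proof. by move=> g; rewrite /ma_mul msupp0 big_seq_fset0. Qed.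
Fact ma_mul0r : right_zero 0 ma_mul.
Proof.
by move=> g; rewrite /ma_mul big1 // => k _; rewrite msupp0 big_seq_fset0.
Qed.

Fact ma_mulA : associative ma_mul.
Proof.
elim/ma_ind=> [g h|f f' IHf IHf' g h|c k]; first by rewrite !ma_mul0l.
  by rewrite !ma_mulDl IHf IHf'.
elim/ma_ind=> [h|g g' IHg IHg' h|c' k'].
- by rewrite ma_mul0r !ma_mul0l ma_mul0r.
- by rewrite !(ma_mulDl, ma_mulDr) IHg IHg'.
elim/ma_ind=> [|h h' IHh IHh'|c2 k2]; first by rewrite !ma_mul0r.
  by rewrite !ma_mulDr IHh IHh'.
by rewrite !ma_mulUU mulrA mulgA.
Qed.

Fact ma_mul1 : left_id (ma_in 1%g) ma_mul.
Proof.
elim/ma_ind=> [|f g IHf IHg|c k]; first by rewrite ma_mul0r.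
  by rewrite ma_mulDr IHf IHg.
by rewrite ma_mulUU mul1r mul1g.
Qed.
Fact ma_mul1r : right_id (ma_in 1%g) ma_mul.
Proof.
elim/ma_ind=> [|f g IHf IHg|c k]; first by rewrite ma_mul0l.
  by rewrite ma_mulDl IHf IHg.
by rewrite ma_mulUU mulr1 mulg1.
Qed.
HB.instance Definition _ := GRing.Zmodule_isPzRing.Build monAlg
  ma_mulA ma_mul1 ma_mul1r ma_mulDl ma_mulDr.

Definition ma_const (c : K) : monAlg := << c *g 1%g >>.

Fact ma_const_zmod : zmod_morphism ma_const.
Proof. by move=> c c'; rewrite /ma_const monalgUB. Qed.
HB.instance Definition _ := GRing.isZmodMorphism.Build K monAlg ma_const
  ma_const_zmod.
Fact ma_const_monoid : monoid_morphism ma_const.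
Proof. by split=> // c c'; rewrite [RHS]ma_mulUU mulg1. Qed.
HB.instance Definition _ := GRing.isMonoidMorphism.Build K monAlg ma_const
  ma_const_monoid.

Fact ma_constC c f : ma_const c * f = f * ma_const c.
Proof.
elim/ma_ind: f => [|f g IHf IHg|c' k]; first by rewrite mulr0 mul0r.
  by rewrite mulrDl mulrDr IHf IHg.
by rewrite [LHS]ma_mulUU [RHS]ma_mulUU mul1g mulg1 mulrC.
Qed.
HB.instance Definition _ := PzRing_isPzAlgebra.Build K monAlg ma_constC.

Lemma ma_inM k l : ma_in (k * l)%g = ma_in k * ma_in l.
Proof. by rewrite [RHS]ma_mulUU mulr1. Qed.

Lemma ma_in1 : ma_in 1%g = 1. Proof. by []. Qed.

Lemma ma_UE c k : << c *g k >> = c%:K * ma_in k :> monAlg.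
Proof. by rewrite [RHS]ma_mulUU mulr1 mul1g. Qed.

Section Lift.
Context (T : pzAlgType K) (h : M -> T).

Definition ma_lift (_ : h 1%g = 1) (_ : forall k l, h (k * l)%g = h k * h l)
  (f : monAlg) : T := \sum_(k <- msupp f) (mcoeff k f)%:K * h k.

Hypotheses (h1 : h 1%g = 1) (hM : forall k l, h (k * l)%g = h k * h l).
Local Notation L := (ma_lift h1 hM).

Lemma ma_liftw (d : {fset M}) f : msupp f `<=` d ->
  L f = \sum_(k <- d) (mcoeff k f)%:K * h k.
Proof.
move=> le_d; rewrite /ma_lift (big_fset_incl _ le_d) // => k _ /mcoeff_outdom ->.
by rewrite rmorph0 mul0r.
Qed.

Lemma ma_liftU c k : L << c *g k >> = c%:K * h k.
Proof. by rewrite (ma_liftw msuppU_le) big_seq_fset1 mcoeffUU. Qed.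

Lemma ma_lift_in k : L (ma_in k) = h k.
Proof. by rewrite ma_liftU rmorph1 mul1r. Qed.

Lemma ma_liftD f g : L (f + g) = L f + L g.
Proof.
rewrite (ma_liftw (msuppD_le f g)) (ma_liftw (fsubsetUl (msupp f) (msupp g))).
rewrite (ma_liftw (fsubsetUr (msupp f) (msupp g))) -big_split /=.
by apply/eq_bigr=> k _; rewrite mcoeffD rmorphD mulrDl.
Qed.

Lemma ma_lift0 : L 0 = 0.
Proof. by rewrite /ma_lift msupp0 big_seq_fset0. Qed.

Fact ma_lift_zmod : zmod_morphism L.
Proof.
by move=> f g; apply/eqP; rewrite eq_sym subr_eq -ma_liftD subrK.
Qed.
HB.instance Definition _ := GRing.isZmodMorphism.Build monAlg T L ma_lift_zmod.

Fact ma_lift_monoid : monoid_morphism L.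
Proof.
split; first by rewrite -ma_in1 ma_lift_in.
elim/ma_ind=> [g|f f' IHf IHf' g|c k]; first by rewrite mul0r ma_lift0 mul0r.
  by rewrite mulrDl !ma_liftD IHf IHf' mulrDl.
elim/ma_ind=> [|g g' IHg IHg'|c' k']; first by rewrite mulr0 ma_lift0 mulr0.
  by rewrite mulrDr !ma_liftD IHg IHg' mulrDr.
rewrite [_ * _]ma_mulUU !ma_liftU hM rmorphM -!mulrA; congr (_ * _).
by rewrite mulrA pz_in_algC -mulrA.
Qed.
HB.instance Definition _ := GRing.isMonoidMorphism.Build monAlg T L
  ma_lift_monoid.

Fact ma_lift_morphK (c : K) : L c%:K = c%:K.
Proof. by rewrite ma_liftU h1 mulr1. Qed.
HB.instance Definition _ := isPzAlgMorphism.Build K monAlg T L ma_lift_morphK.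
End Lift.
End MonoidAlgebra.

Arguments ma_in {K M} k.

Definition freeMonoid (X : Type) : Type := seq X.
Section FreeMonoid.
Context (X : choiceType).
HB.instance Definition _ := Choice.on (freeMonoid X).
HB.instance Definition _ :=
  isMonoid.Build (freeMonoid X) (@catA X) (@cat0s X) (@cats0 X).
End FreeMonoid.

Definition freeAlg (K : comPzRingType) (X : choiceType) : Type :=
  monAlg K (freeMonoid X).
HB.instance Definition _ K X := PzAlgebra.on (freeAlg K X).

Definition fa_gen (K : comPzRingType) (X : choiceType) (g : X) : freeAlg K X :=
  ma_in ([:: g] : freeMonoid X).

(* ------------------------------------------------------------------------ *)
(* Group presented by generators X and relations w = w', where a word is a  *)
(* list of letters (g, b) standing for g when b = false and for g^-1 when   *)
(* b = true.                                                                *)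

Inductive word_eq (X : Type) (rel : seq (X * bool) -> seq (X * bool) -> Prop) :
  seq (X * bool) -> seq (X * bool) -> Prop :=
| word_eq_refl w : word_eq rel w w
| word_eq_sym w w' : word_eq rel w w' -> word_eq rel w' w
| word_eq_trans w1 w2 w3 :
    word_eq rel w1 w2 -> word_eq rel w2 w3 -> word_eq rel w1 w3
| word_eq_cat w1 w2 w1' w2' :
    word_eq rel w1 w1' -> word_eq rel w2 w2' ->
    word_eq rel (w1 ++ w2) (w1' ++ w2')
| word_eq_cancel g b : word_eq rel [:: (g, b); (g, ~~ b)] [::]
| word_eq_rel w w' : rel w w' -> word_eq rel w w'.

Section PresentedGroup.
Context (X : choiceType).
Local Notation word := (seq (X * bool)).
Context (rel : word -> word -> Prop).

Definition word_eqb (w w' : word) : bool := `[< word_eq rel w w' >].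

Fact word_eqb_equiv : equiv_class_of word_eqb.
Proof.
split=> [w|w w'|w' w w2]; first exact/asboolP/word_eq_refl.
  by apply/asboolP/asboolP; apply: word_eq_sym.
by move=> /asboolP h /asboolP h'; apply/asboolP/(word_eq_trans h).
Qed.
Canonical word_equiv := EquivRelPack word_eqb_equiv.
Canonical word_encModRel := defaultEncModRel word_eqb.

Definition presGroup : Type := {eq_quot word_eqb}.
HB.instance Definition _ := EqQuotient.on presGroup.
HB.instance Definition _ := Choice.on presGroup.

Definition pg_word (w : word) : presGroup := \pi_presGroup w.

Lemma pg_wordP w w' : pg_word w = pg_word w' <-> word_eq rel w w'.
Proof.
rewrite /pg_word; split=> [/eqP|h]; first by rewrite piE => /asboolP.
by apply/eqP; rewrite piE; apply/asboolP.
Qed.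

Lemma pgW (P : presGroup -> Prop) : (forall w, P (pg_word w)) -> forall z, P z.
Proof. by move=> h z; rewrite -[z]reprK. Qed.

Lemma repr_pg w : word_eq rel (repr (pg_word w)) w.
Proof. by apply/pg_wordP; rewrite /pg_word reprK. Qed.

Definition word_inv (w : word) : word := rev [seq (l.1, ~~ l.2) | l <- w].

Lemma word_inv_cat w w' : word_inv (w ++ w') = word_inv w' ++ word_inv w.
Proof. by rewrite /word_inv map_cat rev_cat. Qed.

Lemma word_invK : involutive word_inv.
Proof.
move=> w; rewrite /word_inv map_rev revK -map_comp -[RHS]map_id.
by apply: eq_map => -[g b] /=; rewrite negbK.
Qed.

Lemma word_mulVw w : word_eq rel (word_inv w ++ w) [::].
Proof.
elim: w => [|[g b] w IHw]; first exact: word_eq_refl.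
rewrite -cat1s word_inv_cat -catA; apply: word_eq_trans IHw.
apply: word_eq_cat (word_eq_refl _ _) _; rewrite catA -[w in X in word_eq _ _ X]cat0s.
apply: word_eq_cat _ (word_eq_refl _ _).
by have := word_eq_cancel rel g (~~ b); rewrite negbK.
Qed.

Lemma word_mulwV w : word_eq rel (w ++ word_inv w) [::].
Proof. by rewrite -[w in w ++ _]word_invK; apply: word_mulVw. Qed.

Definition pg_mul (z z' : presGroup) := pg_word (repr z ++ repr z').
Definition pg_inv (z : presGroup) := pg_word (word_inv (repr z)).

Lemma pg_mulE w w' : pg_mul (pg_word w) (pg_word w') = pg_word (w ++ w').
Proof. by apply/pg_wordP/word_eq_cat; apply: repr_pg. Qed.

Fact pg_mulA : associative pg_mul.
Proof. by elim/pgW=> w; elim/pgW=> w'; elim/pgW=> w2; rewrite !pg_mulE catA. Qed.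
Fact pg_mul1 : left_id (pg_word [::]) pg_mul.
Proof. by elim/pgW=> w; rewrite pg_mulE. Qed.
Fact pg_mul1r : right_id (pg_word [::]) pg_mul.
Proof. by elim/pgW=> w; rewrite pg_mulE cats0. Qed.
Fact pg_mulV : left_inverse (pg_word [::]) pg_inv pg_mul.
Proof.
move=> z; rewrite -{2}[z]reprK [pg_mul _ _]pg_mulE.
exact/pg_wordP/word_mulVw.
Qed.
Fact pg_mulrV : right_inverse (pg_word [::]) pg_inv pg_mul.
Proof.
move=> z; rewrite -{1}[z]reprK [pg_mul _ _]pg_mulE.
exact/pg_wordP/word_mulwV.
Qed.
HB.instance Definition _ :=
  isGroup.Build presGroup pg_mulA pg_mul1 pg_mul1r pg_mulV pg_mulrV.

Definition pg_gen (g : X) : presGroup := pg_word [:: (g, false)].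
End PresentedGroup.

(* ------------------------------------------------------------------------ *)
(* Extension of scalars E (x)_K L along f : K -> L: the free L-module on    *)
(* the elements [u] of E modulo K-linearity in u. It is an L-algebra for    *)
(* [u][v] = [uv]; as left and right multiplication by [w] permute the       *)
(* relations below, the two-sided ideal that they generate is the           *)
(* L-submodule that they span.                                              *)

Definition mulMonoid (E : Type) : Type := E.
Section MulMonoid.
Context (E : pzRingType).
HB.instance Definition _ := Choice.on (mulMonoid E).
HB.instance Definition _ :=
  isMonoid.Build (mulMonoid E) (@mulrA E) (@mul1r E) (@mulr1 E).
End MulMonoid.

Definition ten_in (L : comPzRingType) (E : pzRingType) (u : E) :
  monAlg L (mulMonoid E) := ma_in (u : mulMonoid E).

Inductive tensor_rel (K L : comPzRingType) (f : K -> L) (E : pzAlgType K) :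
  monAlg L (mulMonoid E) -> Prop :=
| tensor_rel_add (u v : E) :
    tensor_rel f (ten_in L (u + v) - (ten_in L u + ten_in L v))
| tensor_rel_scale (k : K) (u : E) :
    tensor_rel f (ten_in L (k%:K * u) - (f k)%:K * ten_in L u).

Definition tensor (K L : comPzRingType) (f : K -> L) (E : pzAlgType K) :
  pzAlgType L := ringQuot (@tensor_rel K L f E).

Section Tensor.
Context (K L : comPzRingType) (f : {rmorphism K -> L}) (E : pzAlgType K).
Local Notation T := (tensor f E).

Definition tens (u : E) (a : L) : T :=
  a%:K * rq (@tensor_rel K L f E) (ten_in L u).

Lemma tensDl u v a : tens (u + v) a = tens u a + tens v a.
Proof.
rewrite /tens -mulrDr -rmorphD; congr (_ * _); apply/eqP.
by rewrite -subr_eq0 -rmorphB; apply/eqP/rq_rel/tensor_rel_add.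
Qed.

Lemma tensDr u a b : tens u (a + b) = tens u a + tens u b.
Proof. by rewrite /tens rmorphD mulrDl. Qed.

Lemma tensZ k u a : tens (k%:K * u) a = tens u (f k * a).
Proof.
rewrite /tens [f k * a]mulrC rmorphM -mulrA; congr (_ * _); apply/eqP.
rewrite -subr_eq0 -(rq_morphK (@tensor_rel K L f E)) -rmorphM -rmorphB.
exact/eqP/rq_rel/tensor_rel_scale.
Qed.

Lemma ten_inM (u v : E) : ten_in L (u * v) = ten_in L u * ten_in L v.
Proof. exact: ma_inM. Qed.

Lemma tensM u v a b : tens u a * tens v b = tens (u * v) (a * b).
Proof.
rewrite /tens pzalg_mulACA ten_inM; congr (_ * _).
exact: esym (rmorphM _ _ _).
Qed.

Lemma tens1 : tens 1 1 = 1.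
Proof. by rewrite /tens rmorph1 mul1r -(rmorph1 (rq _)). Qed.

Lemma tensK (a b : L) u : a%:K * tens u b = tens u (a * b).
Proof. by rewrite /tens rmorphM mulrA. Qed.

Section Lift.
Context (B : pzAlgType L) (g : {rmorphism E -> B}).

Fact tensor_lift_g1 : g 1 = 1. Proof. exact: rmorph1. Qed.
Fact tensor_lift_gM u v : g (u * v) = g u * g v. Proof. exact: rmorphM. Qed.

Definition tensor_lift0 : {pzalg monAlg L (mulMonoid E) -> B} :=
  @ma_lift L (mulMonoid E) B g tensor_lift_g1 tensor_lift_gM.

Lemma tensor_lift0E u : tensor_lift0 (ten_in L u) = g u.
Proof. exact: ma_lift_in. Qed.

Hypothesis gK : forall k, g k%:K = (f k)%:K.

Fact tensor_lift0_rel w : tensor_rel f w -> tensor_lift0 w = 0.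
Proof.
have lE := tensor_lift0E; case=> [u v|k u].
  by rewrite rmorphB rmorphD /= !lE rmorphD subrr.
rewrite rmorphB rmorphM /= !lE rmorphM gK.
by rewrite (pzalg_morphK (s := tensor_lift0)) subrr.
Qed.

Definition tensor_lift : {pzalg T -> B} := rq_lift tensor_lift0_rel.

Lemma tensor_liftE u a : tensor_lift (tens u a) = a%:K * g u.
Proof.
rewrite /tens; apply: etrans (rmorphM tensor_lift _ _) _; congr (_ * _).
  exact: (pzalg_morphK (s := tensor_lift)).
exact: etrans (rq_liftE _ _) (tensor_lift0E u).
Qed.
End Lift.
End Tensor.

Section TensorMap.
Context (K L : comPzRingType) (f : {rmorphism K -> L}) (E E' : pzAlgType K).

Definition tens_l (v : E') : tensor f E' := tens f v 1.

Fact tens_l_zmod : zmod_morphism tens_l.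
Proof.
by move=> u v; apply/eqP; rewrite eq_sym subr_eq /tens_l -tensDl subrK.
Qed.
HB.instance Definition _ := GRing.isZmodMorphism.Build E' (tensor f E') tens_l
  tens_l_zmod.
Fact tens_l_monoid : monoid_morphism tens_l.
Proof. by split=> [|u v]; rewrite ?[tens_l 1]tens1 // /tens_l tensM mul1r. Qed.
HB.instance Definition _ := GRing.isMonoidMorphism.Build E' (tensor f E') tens_l
  tens_l_monoid.

Context (phi : {pzalg E -> E'}).

Fact tens_l_phiK (k : K) : (tens_l \o phi) k%:K = (f k)%:K.
Proof.
rewrite /= pzalg_morphK /tens_l -[k%:K]mulr1 tensZ mulr1.
by rewrite -[f k]mulr1 -tensK tens1 !mulr1.
Qed.

Definition tensor_map : {pzalg tensor f E -> tensor f E'} :=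
  tensor_lift tens_l_phiK.

Lemma tensor_mapE u a : tensor_map (tens f u a) = tens f (phi u) a.
Proof. by rewrite /tensor_map tensor_liftE /= /tens_l tensK mulr1. Qed.
End TensorMap.

(* ------------------------------------------------------------------------ *)
(* R = Q[a,b,c,(abc)^-1], x = b + c, y = bc, S = R[x^-1]; the suffix dd is  *)
(* for the double dagger: Sdd = S/(a^2 - 1, y - 1).                         *)

Definition polyQ3 : comNzRingType := {mpoly rat[3]}.
Definition poly_a : polyQ3 := 'X_(@Ordinal 3 0 isT).
Definition poly_b : polyQ3 := 'X_(@Ordinal 3 1 isT).
Definition poly_c : polyQ3 := 'X_(@Ordinal 3 2 isT).

Definition ringR : comPzRingType := loc (poly_a * poly_b * poly_c).
Definition Ra : ringR := loc_in _ poly_a.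
Definition Rb : ringR := loc_in _ poly_b.
Definition Rc : ringR := loc_in _ poly_c.
Definition Rx : ringR := Rb + Rc.
Definition Ry : ringR := Rb * Rc.

Definition ringS : comPzRingType := loc Rx.
Definition R_to_S : {rmorphism ringR -> ringS} := loc_in Rx.

Inductive Sdd_rel : ringS -> Prop :=
| Sdd_rel_a : Sdd_rel (R_to_S Ra ^+ 2 - 1)
| Sdd_rel_y : Sdd_rel (R_to_S Ry - 1).

Definition ringSdd : comPzRingType := ringQuot Sdd_rel.
Definition S_to_Sdd : {rmorphism ringS -> ringSdd} := rq Sdd_rel.
Definition R_to_Sdd : {rmorphism ringR -> ringSdd} := S_to_Sdd \o R_to_S.
Definition Sdda : ringSdd := R_to_Sdd Ra.
Definition Sddx : ringSdd := R_to_Sdd Rx.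

Definition ringSddloc : comPzRingType := loc (Sddx + 2%:R * Sdda).
Definition Sdd_to_loc : {rmorphism ringSdd -> ringSddloc} :=
  loc_in (Sddx + 2%:R * Sdda).

(* ------------------------------------------------------------------------ *)
(* A = Q[a,x,x^-1]/(a^2 - 1) and the morphism A -> Sdd, a |-> a, x |-> b+c. *)

Definition polyQ2 : comNzRingType := {mpoly rat[2]}.
Definition ringA0 : comPzRingType := loc ('X_(@Ordinal 2 1 isT) : polyQ2).
Definition A0a : ringA0 := loc_in _ ('X_(@Ordinal 2 0 isT) : polyQ2).

Inductive A_rel : ringA0 -> Prop := A_rel_a : A_rel (A0a ^+ 2 - 1).

Definition ringA : comPzRingType := ringQuot A_rel.
Definition Aa : ringA := rq A_rel A0a.
Definition Ax : ringA := rq A_rel (loc_in _ ('X_(@Ordinal 2 1 isT) : polyQ2)).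
Definition AxV : ringA := rq A_rel (loc_inv _).

Lemma Aa2 : Aa ^+ 2 = 1.
Proof.
apply/eqP; rewrite -subr_eq0 -(rmorph1 (rq A_rel)) -rmorphXn -rmorphB.
exact/eqP/rq_rel/A_rel_a.
Qed.

Lemma AxK : Ax * AxV = 1.
Proof. by rewrite -rmorphM loc_inK. Qed.

Definition polyQ2_to_polyQ3 : {rmorphism polyQ2 -> polyQ3} :=
  comp_mpoly [tuple poly_a; poly_b + poly_c].

Lemma polyQ2_to_polyQ3a : polyQ2_to_polyQ3 'X_(@Ordinal 2 0 isT) = poly_a.
Proof. exact: comp_mpolyXU. Qed.

Lemma polyQ2_to_polyQ3x :
  polyQ2_to_polyQ3 'X_(@Ordinal 2 1 isT) = poly_b + poly_c.
Proof. exact: comp_mpolyXU. Qed.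

Definition polyQ2_to_Sdd : {rmorphism polyQ2 -> ringSdd} :=
  R_to_Sdd \o (loc_in (poly_a * poly_b * poly_c) : {rmorphism _ -> ringR})
  \o polyQ2_to_polyQ3.

Lemma polyQ2_to_Sdd_a : polyQ2_to_Sdd 'X_(@Ordinal 2 0 isT) = Sdda.
Proof. by rewrite /polyQ2_to_Sdd /= polyQ2_to_polyQ3a. Qed.

Lemma polyQ2_to_Sdd_x : polyQ2_to_Sdd 'X_(@Ordinal 2 1 isT) = Sddx.
Proof. by rewrite /polyQ2_to_Sdd /= polyQ2_to_polyQ3x (rmorphD (loc_in _)). Qed.

Fact polyQ2_to_Sdd_xK :
  polyQ2_to_Sdd 'X_(@Ordinal 2 1 isT) * S_to_Sdd (loc_inv Rx) = 1.
Proof.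
rewrite polyQ2_to_Sdd_x -(rmorph1 S_to_Sdd).
by rewrite -[RHS](congr1 S_to_Sdd (loc_inK Rx)) rmorphM.
Qed.

Definition A0_to_Sdd : {rmorphism ringA0 -> ringSdd} :=
  loc_lift polyQ2_to_Sdd_xK.

Lemma A0_to_Sdd_a : A0_to_Sdd A0a = Sdda.
Proof. exact: etrans (loc_lift_in _ _) polyQ2_to_Sdd_a. Qed.

Fact A0_to_Sdd_rel u : A_rel u -> A0_to_Sdd u = 0.
Proof.
case; rewrite rmorphB rmorphXn rmorph1 A0_to_Sdd_a.
apply: etrans (rq_rel Sdd_rel_a).
by rewrite (rmorphB (rq _)) (rmorphXn (rq _)) (rmorph1 (rq _)).
Qed.

Definition A_to_Sdd : {rmorphism ringA -> ringSdd} := rq_lift A0_to_Sdd_rel.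

Lemma A_to_Sdd_a : A_to_Sdd Aa = Sdda.
Proof. exact: etrans (rq_liftE _ _) A0_to_Sdd_a. Qed.

Lemma A_to_Sdd_x : A_to_Sdd Ax = R_to_Sdd (Rb + Rc).
Proof.
apply: etrans (rq_liftE _ _) _; apply: etrans (loc_lift_in _ _) _.
exact: polyQ2_to_Sdd_x.
Qed.

(* ------------------------------------------------------------------------ *)
(* Indices are shifted by one: i : 'I_n.-1 = {0, .., n-2} refers to s_(i+1), *)
(* e_(i+1).                                                                 *)

Definition far (n : nat) (i j : 'I_n) : bool := (i.+1 < j)%N || (j.+1 < i)%N.
Definition adjacent (n : nat) (i j : 'I_n) : bool :=
  (j == i.+1 :> nat) || (i == j.+1 :> nat).

Inductive braid_rel (n : nat) :
  seq ('I_n.-1 * bool) -> seq ('I_n.-1 * bool) -> Prop :=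
| braid_rel3 (i j : 'I_n.-1) : j = i.+1 :> nat ->
    braid_rel [:: (i, false); (j, false); (i, false)]
              [:: (j, false); (i, false); (j, false)]
| braid_rel2 (i j : 'I_n.-1) : far i j ->
    braid_rel [:: (i, false); (j, false)] [:: (j, false); (i, false)].

Definition braid (n : nat) : groupType := presGroup (@braid_rel n).
Definition artin (n : nat) (i : 'I_n.-1) : braid n := pg_gen _ i.

Definition RB (n : nat) : pzAlgType ringR := monAlg ringR (braid n).

Inductive hecke_rel (n : nat) : RB n -> Prop :=
| hecke_rel_cubic (i : 'I_n.-1) :
    hecke_rel ((ma_in (artin i) - Ra%:K) * (ma_in (artin i) - Rb%:K)
               * (ma_in (artin i) - Rc%:K)).

Definition hecke (n : nat) : pzAlgType ringR := ringQuot (@hecke_rel n).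

Definition hecke_of (n : nat) (g : braid n) : hecke n :=
  rq (@hecke_rel n) (ma_in g).

Definition calR (n : nat) (i j : 'I_n.-1) : hecke n :=
  let s k := hecke_of (artin k) in
  let sV k := hecke_of (artin k)^-1%g in
  - (Ry%:K * (s i * sV j * s i)) + (Ry ^+ 2)%:K * (sV j * s i * sV j)
  - s i * s j * s i - (Rx * Ry ^+ 2)%:K * sV j ^+ 2 + Rx%:K * s i ^+ 2
  + (Ry ^+ 3)%:K * (sV j * sV i * sV j).

Inductive bmw_rel (n : nat) : hecke n -> Prop :=
| bmw_rel_calR (i j : 'I_n.-1) : j = i.+1 :> nat -> bmw_rel (calR i j).

Definition bmw (n : nat) : pzAlgType ringR := ringQuot (@bmw_rel n).

Definition bmwdd (n : nat) : pzAlgType ringSdd := tensor R_to_Sdd (bmw n).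

Definition bmwdd_s (n : nat) (i : 'I_n.-1) : bmwdd n :=
  tens R_to_Sdd (rq (@bmw_rel n) (hecke_of (artin i))) 1.

(* ------------------------------------------------------------------------ *)
(* The algebra F_n. Its generators s_i, e_i, C are encoded as inl (inl i),  *)
(* inl (inr i), inr tt. Expanding the cubic relation gives                  *)
(*   s_i (s_i^2 - (x + a) s_i + (1 + a x)) = a,                             *)
(* and a^2 = 1, whence the expression F_sV for s_i^-1 (see Falg_mulsV and   *)
(* Falg_mulVs below).                                                       *)

Definition F_gen (n : nat) : choiceType := ('I_n.-1 + 'I_n.-1 + unit)%type.
Definition F_free (n : nat) : pzAlgType ringA := freeAlg ringA (F_gen n).

Section FAlgebra.
Context (n : nat).
Definition F_s (i : 'I_n.-1) : F_free n := fa_gen _ (inl (inl i) : F_gen n).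
Definition F_e (i : 'I_n.-1) : F_free n := fa_gen _ (inl (inr i) : F_gen n).
Definition F_C : F_free n := fa_gen _ (inr tt : F_gen n).
Definition F_sV (i : 'I_n.-1) : F_free n :=
  Aa%:K * (F_s i ^+ 2 - (Ax + Aa)%:K * F_s i + (1 + Aa * Ax)%:K).
End FAlgebra.

(* F_rel u v imposes the relation u = v. *)
Inductive F_rel (n : nat) : F_free n -> F_free n -> Prop :=
| F_rel_braid (i j : 'I_n.-1) : j = i.+1 :> nat ->
    F_rel (F_s i * F_s j * F_s i) (F_s j * F_s i * F_s j)
| F_rel_comm (i j : 'I_n.-1) : far i j ->
    F_rel (F_s i * F_s j) (F_s j * F_s i)
| F_rel_cubic (i : 'I_n.-1) :
    F_rel ((F_s i - Aa%:K) * (F_s i ^+ 2 - Ax%:K * F_s i + 1)) 0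
| F_rel_e (i : 'I_n.-1) :
    F_rel (F_e i) (Aa%:K * (AxV%:K * (F_sV i + F_s i) - 1))
| F_rel_se (i : 'I_n.-1) : F_rel (F_s i * F_e i) (Aa%:K * F_e i)
| F_rel_ese (i j : 'I_n.-1) : adjacent i j ->
    F_rel (F_e i * F_s j * F_e i) (F_e i + F_C n)
| F_rel_esVe (i j : 'I_n.-1) : adjacent i j ->
    F_rel (F_e i * F_sV j * F_e i) (F_e i + F_C n)
| F_rel_sC (i : 'I_n.-1) : F_rel (F_s i * F_C n) (F_C n * F_s i)
| F_rel_Cs (i : 'I_n.-1) : F_rel (F_C n * F_s i) (Aa%:K * F_C n).

Definition F_ideal (n : nat) (w : F_free n) : Prop :=
  exists u v, F_rel u v /\ w = u - v.

Definition Falg (n : nat) : pzAlgType ringA := ringQuot (@F_ideal n).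

Lemma Falg_rel n u v : F_rel u v -> rq (@F_ideal n) u = rq (@F_ideal n) v.
Proof.
move=> h; apply/eqP; rewrite -subr_eq0 -rmorphB; apply/eqP/rq_rel.
by exists u, v.
Qed.

Lemma cubic_inv (K : comPzRingType) (E : pzAlgType K) (a x : K) (s : E) :
  a ^+ 2 = 1 -> (s - a%:K) * (s ^+ 2 - x%:K * s + 1) = 0 ->
  let sV := a%:K * (s ^+ 2 - (x + a)%:K * s + (1 + a * x)%:K) in
  s * sV = 1 /\ sV * s = 1.
Proof.
move=> a2 h; set P := s ^+ 2 - x%:K * s + 1 in h.
have sP : s * P = a%:K * P by apply/eqP; rewrite -subr_eq0 -mulrBl h.
have Ps : P * s = s * P.
  rewrite /P mulrDl mulrBl mulrDr mulrBr mul1r mulr1 -exprSr -exprS.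
  by rewrite [s * (_ * _)]mulrA -pz_in_algC.
have -> : s ^+ 2 - (x + a)%:K * s + (1 + a * x)%:K = P - a%:K * (s - x%:K).
  rewrite /P rmorphD mulrDl rmorphD rmorph1 rmorphM mulrBr opprB opprD !addrA.
  by rewrite [in LHS](addrAC _ _ 1) [LHS]addrAC.
have aa : a%:K * a%:K = 1 :> E by rewrite -rmorphM -expr2 a2 rmorph1.
have key : a%:K * (P - (s ^+ 2 - x%:K * s)) = a%:K.
  by rewrite /P [X in X - _]addrC addrK mulr1.
have e1 : s * (P - a%:K * (s - x%:K)) = a%:K.
  rewrite mulrBr sP [s * (_ * _)]mulrA -pz_in_algC -mulrA -mulrBr.
  by rewrite [s * (_ - _)]mulrBr -expr2 -pz_in_algC.
have e2 : (P - a%:K * (s - x%:K)) * s = a%:K.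
  by rewrite mulrBl Ps sP -mulrA -mulrBr [(_ - _) * s]mulrBl -expr2.
move=> sV; rewrite /sV; split; last by rewrite -mulrA e2.
by rewrite mulrA -pz_in_algC -mulrA e1.
Qed.

Section CubicMorph.
Context (K : comPzRingType) (E B : pzAlgType K) (g : {rmorphism E -> B}).
Hypothesis gK : forall k : K, g k%:K = k%:K.

Lemma cubic_morph (a x : K) (s : E) :
  g ((s - a%:K) * (s ^+ 2 - x%:K * s + 1))
  = (g s - a%:K) * (g s ^+ 2 - x%:K * g s + 1).
Proof.
by rewrite rmorphM rmorphB [g (_ + 1)]rmorphD rmorphB rmorphXn rmorphM rmorph1 !gK.
Qed.

Lemma cubic_inv_morph (a x : K) (s : E) :
  g (a%:K * (s ^+ 2 - (x + a)%:K * s + (1 + a * x)%:K))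
  = a%:K * (g s ^+ 2 - (x + a)%:K * g s + (1 + a * x)%:K).
Proof.
by rewrite rmorphM [g (_ + _%:K)]rmorphD rmorphB rmorphXn rmorphM !gK.
Qed.
End CubicMorph.

Lemma Falg_cubic n (i : 'I_n.-1) : let s := rq (@F_ideal n) (F_s i) in
  (s - Aa%:K) * (s ^+ 2 - Ax%:K * s + 1) = 0.
Proof.
have h := Falg_rel (F_rel_cubic i).
apply: etrans (esym (cubic_morph (rq_morphK (@F_ideal n)) _ _ _)) _.
exact: etrans h (rmorph0 _).
Qed.

Lemma Falg_sV n (i : 'I_n.-1) : let s := rq (@F_ideal n) (F_s i) in
  rq (@F_ideal n) (F_sV i)
  = Aa%:K * (s ^+ 2 - (Ax + Aa)%:K * s + (1 + Aa * Ax)%:K).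
Proof. exact: (cubic_inv_morph (rq_morphK (@F_ideal n))). Qed.

Lemma Falg_mulsV n (i : 'I_n.-1) :
  rq (@F_ideal n) (F_s i) * rq (@F_ideal n) (F_sV i) = 1.
Proof. by rewrite Falg_sV; case: (cubic_inv Aa2 (Falg_cubic i)). Qed.

Lemma Falg_mulVs n (i : 'I_n.-1) :
  rq (@F_ideal n) (F_sV i) * rq (@F_ideal n) (F_s i) = 1.
Proof. by rewrite Falg_sV; case: (cubic_inv Aa2 (Falg_cubic i)). Qed.

Definition Falgdd (n : nat) : pzAlgType ringSdd := tensor A_to_Sdd (Falg n).

Definition Falgdd_s (n : nat) (i : 'I_n.-1) : Falgdd n :=
  tens A_to_Sdd (rq (@F_ideal n) (F_s i)) 1.

(* Main.v *)
From HB Require Import structures.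
Require Import Defs.
From Stdlib Require Import Ncring Ncring_tac.
From mathcomp Require Import all_boot all_order all_algebra.
From mathcomp Require Import mpoly.

(* Replacing s_i, e_i, x by a s_i, a e_i, a x, one may assume a = 1. Write s, S,
   e and t, V, f for a generator, its inverse and its idempotent, at two adjacent
   indices. As e is (s + S)/x - 1, the relation calR is x (V e V - s f s), and the
   braid relation gives s t e = f s t.
   In F_n: s t e V e = f s e = f e and e V e = e + C yield s t e = f e - C; hence
   t s^2 t e = e, which is equivalent to s f s = V e V. So the morphism exists.
   Conversely, s f s = V e V gives t s^2 t e = e, and then C := e t e - e equals
   f e - s t e; this yields the relations of F_n at two indices, and shows that C is
   symmetric in the two indices. Let p and q be the elements C of (1,2) and (2,3).
   Computing e1 s3 s2 e3 e1 in two ways, for s and for s^-1, gives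
   (x + 2) e3 p e3 = (4/x - x) p e3, which is where x + 2a must be inverted; so
   s3 p e3 = p e3. Then s2 s1 s3 s2 e1 e3 = e1 e3 + p e3 - q e1, and exchanging 1
   and 3 gives p e3 = q e1, likewise e3 p = e1 q. Finally e2 e1 e2 e3 e2 computed in
   two ways gives p - q = p e3 e2 - e2 e1 q, whose right-hand side is symmetric under
   the exchange of 1 and 3; hence p = q, and all the C coincide. *)

Set Implicit Arguments.
Unset Strict Implicit.
Unset Printing Implicit Defensive.

Import GRing.Theory.
Local Open Scope ring_scope.

(** * Certified linear combinations in noncommutative rings *)

#[local] Instance ring_ops (T : pzRingType) :
  @Ring_ops T 0 1 +%R *%R (fun x y => x - y) -%R eq := {}.
(** Opens every [pzRingType], with Leibniz equality, to the tactic [non_commutative_ring]. *)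
#[local] Instance ring_ncring (T : pzRingType) :
  @Ring T _ _ _ _ _ _ _ (ring_ops T).
Proof.
split; try (by move=> ? ? -> ? ? ->); try (by move=> ? ? ->); rewrite /=.
- by split; [|move=> ? ? ->|move=> ? ? ? -> ->].
- exact: add0r.
- exact: addrC.
- exact: addrA.
- exact: mul1r.
- exact: mulr1.
- exact: mulrA.
- exact: mulrDl.
- by move=> x y z; apply: mulrDr.
- by [].
- exact: subrr.
Qed.

Lemma subst_eq (T : pzRingType) (u v x y : T) : u = v -> x - y = u - v -> x = y.
Proof. by move=> -> h; apply: subr0_eq; rewrite h subrr. Qed.

Lemma scale_eq (T : pzRingType) (u v l r : T) : u = v -> l * u * r = l * v * r.
Proof. by move->. Qed.

Lemma add_eq (T : pzRingType) (u v x y : T) : u = v -> x = y -> u + x = v + y.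
Proof. by move=> -> ->. Qed.

Local Notation "l <( h )> r" := (scale_eq l r h) (at level 40, h at level 200).
Local Notation "h :+ k" := (add_eq h k) (at level 50, left associativity).

(* [lincomb (l <( h )> r :+ ...)] proves an equation by exhibiting it as a
   two-sided linear combination of the equations [h]. *)
Tactic Notation "lincomb" uconstr(h) :=
  refine (subst_eq h _); non_commutative_ring.

(** * Skein relations at two and three indices *)

(* X and Y stand for x and x^-1, after the rescaling that makes a = 1. *)
Section Skein.
Context (T : pzRingType) (X Y : T).

(** With [skein_sum] solved for [e], the last field is the cubic relation for a = 1, in the form
    [(s - 1) (s + S - X) = 0]. *)
Record skein (s S e : T) : Prop := Skein {
  skein_sS : s * S = 1;
  skein_Ss : S * s = 1;
  skein_sum : s + S = X * (1 + e);
  skein_se : s * e = e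
}.

Record bmw_pair (s S e t V f : T) : Prop := BmwPair {
  pair_l : skein s S e;
  pair_r : skein t V f;
  pair_braid : s * t * s = t * s * t;
  pair_rel : s * f * s = V * e * V
}.

Hypotheses (XC : forall u, X * u = u * X) (YX : Y * X = 1).

Lemma mulXI u v : X * u = X * v -> u = v.
Proof. by move=> /(congr1 ( *%R Y)); rewrite !mulrA YX !mul1r. Qed.

Section One.
Context (s S e : T) (hs : skein s S e).

(** [X (1 + e) = s + S] commutes with [s], and the central unit [X] cancels. *)
Lemma skein_es : e * s = e.
Proof.
case: hs => sS Ss sum se; apply: mulXI.
lincomb ((-1) <(sum)> s :+ s <(sum)> 1 :+ 1 <(Ss)> 1 :+ (-1) <(sS)> 1
  :+ (-1) <(XC s)> (1 + e) :+ X <(se)> 1).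
Qed.

Lemma skein_Se : S * e = e.
Proof. by rewrite -[in LHS](skein_se hs) mulrA (skein_Ss hs) mul1r. Qed.

Lemma skein_eS : e * S = e.
Proof. by rewrite -[in LHS]skein_es -mulrA (skein_sS hs) mulr1. Qed.

Lemma skein_inv : skein S s e.
Proof.
split; [exact: skein_Ss hs|exact: skein_sS hs| |exact: skein_Se].
by rewrite addrC (skein_sum hs).
Qed.

Lemma skein_ss : s * s = X * (s + e) - 1.
Proof.
case: hs => sS Ss sum se.
lincomb (s <(sum)> 1 :+ (-1) <(sS)> 1 :+ (-1) <(XC s)> (1 + e) :+ X <(se)> 1).
Qed.

(** [e (s + S)] is [2 e] on the one hand and [X (e + e e)] on the other. *)
Lemma skein_ee : e * e = (Y + Y) * e - e.
Proof.
case: hs => sS Ss sum se.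
lincomb ((- (Y * e)) <(sum)> 1 :+ Y <(skein_es)> 1 :+ Y <(skein_eS)> 1
  :+ Y <(XC e)> (1 + e) :+ (-1) <(YX)> (e + e * e)).
Qed.
End One.

(** The braid relation says that [s t] conjugates [s] to [t], hence [S] to [V], hence [X (1 + e)] to
    [X (1 + f)]. *)
Lemma braid_conj s S e t V f : skein s S e -> skein t V f ->
  s * t * s = t * s * t -> s * t * e = f * (s * t).
Proof.
move=> [sS Ss sum se] [tV Vt tum tf] br; apply: mulXI.
lincomb ((- (s * t)) <(sum)> 1 :+ 1 <(tum)> (s * t) :+ 1 <(br)> 1
  :+ (- V) <(br)> S :+ (V * s * t) <(sS)> 1 :+ (-1) <(Vt)> (s * t * S)
  :+ 1 <(XC (s * t))> (1 + e)).
Qed.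

(** [s (s t e) = s f s t = V e V t]. *)
Lemma pair_sste s S e t V f : bmw_pair s S e t V f -> s * s * t * e = V * e.
Proof.
move=> [hs ht br rel]; have cj := braid_conj hs ht br.
case: hs ht => [sS Ss sum se] [tV Vt tum tf].
lincomb (s <(cj)> 1 :+ 1 <(rel)> t :+ (V * e) <(Vt)> 1).
Qed.

Lemma pair_ete s S e t V f : bmw_pair s S e t V f ->
  e * t * e = e + (f * e - s * t * e).
Proof.
move=> P; have A := pair_sste P; case: P => [hs ht br rel].
have cj := braid_conj hs ht br; have ss := skein_ss hs; have tt := skein_ss ht.
have Vf := skein_Se ht; case: hs ht => [sS Ss sum se] [tV Vt tum tf].
(* [t s s t e = e] by [pair_sste]; expand [s s] and [t t] by [skein_ss], with
   [t s t e = s t s e = s t e]. *)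
have tete : t * e * t * e = t * e + f * e - s * t * e.
  apply: mulXI; lincomb (t <(A)> 1 :+ 1 <(tV)> e :+ (- t) <(ss)> (t * e)
    :+ 1 <(tt)> e :+ 1 <(XC t)> (s * t * e + e * t * e) :+ X <(br)> e
    :+ (- (X * s * t)) <(se)> 1).
(* Multiply by [V] on the left; [V s t e = V f s t = f s t = s t e]. *)
lincomb (V <(tete)> 1 :+ (-1) <(Vt)> (e * t * e - e) :+ 1 <(Vf)> (e - s * t)
  :+ (- V + 1) <(cj)> 1).
Qed.
End Skein.

(** * Symmetries of the relations at two indices: reversal, exchange, inversion *)

Section SkeinPair.
Context (T : pzRingType) (X Y : T).
Hypotheses (XC : forall u, X * u = u * X) (YX : Y * X = 1).

(* The relations are invariant under reversal of products, so mirror images of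
   lemmas are obtained by applying them in the converse ring T^c. *)
Lemma skein_conv s S e : skein X s S e -> @skein T^c X s S e.
Proof.
move=> hs; have es := skein_es XC YX hs; case: hs => sS Ss sum _.
by split=> //; apply: etrans sum _; apply: XC.
Qed.

Lemma pair_conv s S e t V f : bmw_pair X s S e t V f ->
  @bmw_pair T^c X s S e t V f.
Proof.
case=> hs ht br rel; split; try exact: skein_conv.
  by have H : s * (t * s) = t * (s * t) by rewrite !mulrA.
by have H : s * (f * s) = V * (e * V) by rewrite !mulrA.
Qed.

Let XCc : forall u : T^c, (X : T^c) * u = u * (X : T^c).
Proof. by move=> u; apply: esym (XC u). Qed.

Let YXc : (Y : T^c) * (X : T^c) = 1.
Proof. by have H : X * Y = 1 by rewrite XC. Qed.

Section Pair.
Context (s S e t V f : T) (P : bmw_pair X s S e t V f).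

Lemma pair_etss : e * t * s * s = e * V.
Proof.
have H := pair_sste XCc YXc (pair_conv P).
by have <- : e * (t * (s * s)) = e * V := H; rewrite !mulrA.
Qed.

Lemma pair_ete_conv : e * t * e = e + (e * f - e * t * s).
Proof.
have H := pair_ete XCc YXc (pair_conv P).
have H' : e * (t * e) = e + (e * f - e * (t * s)) := H.
by rewrite -mulrA H' !mulrA.
Qed.

(** [pair_etss] gives [t e t = t e V S S], and [braid_conj] gives [t e V = S f s]; so
    [t e t = S f S]. *)
Lemma pair_swap : bmw_pair X t V f s S e.
Proof.
have A := pair_etss; case: P => hs ht br rel; split=> //.
have cj := braid_conj XC YX hs ht br.
case: hs ht => [sS Ss sum se] [tV Vt tum tf].
lincomb (t <(A)> (S * S) :+ (- (t * e * t * s)) <(sS)> S :+ (- (t * e * t)) <(sS)> 1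
  :+ S <(cj)> (V * S * S) :+ (-1) <(Ss)> (t * e * V * S * S)
  :+ (S * f * s) <(tV)> (S * S) :+ (S * f) <(sS)> S).
Qed.
End Pair.

(** For the inverses the relation to be proved is [S f S = t e t], that of the exchanged pair. *)
Lemma pair_inv s S e t V f : bmw_pair X s S e t V f ->
  bmw_pair X S s e V t f.
Proof.
move=> P; have := pair_rel (pair_swap P); case: P => hs ht br _ rel.
split; try exact: skein_inv; last by rewrite rel.
case: hs ht => [sS Ss _ _] [tV Vt _ _].
(* [S V S] and [V S V] are inverses of the two sides of the braid relation. *)
have tst : t * s * t * (V * S * V) = 1.
  by rewrite !mulrA -(mulrA _ t V) tV mulr1 -(mulrA _ s S) sS mulr1.
have sts : S * V * S * (s * t * s) = 1.
  by rewrite !mulrA -(mulrA _ S s) Ss mulr1 -(mulrA _ V t) Vt mulr1.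
by rewrite -[LHS]mulr1 -tst mulrA -br sts mul1r.
Qed.

Section PairC.
Context (s S e t V f : T) (P : bmw_pair X s S e t V f).
Let C := e * t * e - e.

(** The mirror formula gives [C = e f - e t s], the exchanged pair gives [f s f - f = e f - t s f],
    and [braid_conj] identifies [e t s] with [t s f]. *)
Lemma pair_fsf : f * s * f - f = C.
Proof.
rewrite /C (pair_ete_conv P) (pair_ete XC YX (pair_swap P)).
case: P => hs ht br _; have cj := braid_conj XC YX ht hs (esym br).
lincomb ((-1) <(cj)> 1).
Qed.

Lemma pair_sC : s * C = C.
Proof.
have := skein_se (pair_l P); rewrite /C => se.
lincomb (1 <(se)> (t * e - 1)).
Qed.

Lemma pair_Cs : C * s = C.
Proof.
have := skein_es XC YX (pair_l P); rewrite /C => es.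
lincomb ((e * t - 1) <(es)> 1).
Qed.

(** Multiply [pair_ete] by [e] on the left: [e s t e] becomes [e t e], and [e e] is a multiple of
    [e]. *)
Lemma pair_efe : e * f * e = e + (Y + Y) * C.
Proof.
have ee := skein_ee XC YX (pair_l P); have es := skein_es XC YX (pair_l P).
have ete := pair_ete XC YX P; rewrite /C.
lincomb ((- e) <(ete)> 1 :+ 1 <(ee)> (t * e - 1) :+ 1 <(es)> (t * e)).
Qed.

(** Put [t + V = X (1 + f)] between two factors [e] and apply [pair_efe]. *)
Lemma pair_eVe : e * V * e = e + C.
Proof.
have efe := pair_efe; have ee := skein_ee XC YX (pair_l P).
have tum := skein_sum (pair_r P); have XY : X * Y = 1 by rewrite XC.
move: efe; rewrite /C => efe.
lincomb (e <(tum)> e :+ (-1) <(XC e)> ((1 + f) * e) :+ X <(ee)> 1 :+ X <(efe)> 1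
  :+ 1 <(XY)> (e * t * e + e * t * e)).
Qed.
End PairC.
End SkeinPair.

(** * From the relations of F_n to the relation calR *)

Section Converse.
Context (T : pzRingType) (X Y : T).
Hypotheses (XC : forall u, X * u = u * X) (YX : Y * X = 1).

Lemma cross_rel s S e t V f C : skein X s S e -> skein X t V f ->
  s * t * s = t * s * t -> e * t * e = e + C -> e * V * e = e + C ->
  s * C = C -> t * C = C -> s * f * s = V * e * V.
Proof.
move=> hs ht br ete eVe sC tC; have cj := braid_conj XC YX hs ht br.
have ss := skein_ss XC hs; have tt := skein_ss XC ht.
case: hs ht => [sS Ss sum se] [tV Vt tum tf].
have ste : s * t * e = f * e - C.
  lincomb ((- (s * t)) <(eVe)> 1 :+ 1 <(cj)> (V * e) :+ (f * s) <(tV)> e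
    :+ f <(se)> 1 :+ (- s) <(tC)> 1 :+ (-1) <(sC)> 1).
(* The expansion used for [pair_ete], now with [t e t e = t e + C] known; the two occurrences of [C]
   cancel. *)
have tsste : t * s * s * t * e = e.
  lincomb (t <(ss)> (t * e) :+ (-1) <(tt)> e :+ (-1) <(XC t)> (s * t * e + e * t * e)
    :+ (- X) <(br)> e :+ (X * s * t) <(se)> 1 :+ X <(ste)> 1 :+ (X * t) <(ete)> 1
    :+ X <(tC)> 1).
(* By conjugation [f = s t e V S], so [s f s = s s t e V]; and [tsste] says that [s s t e = V e]. *)
lincomb ((- s) <(cj)> (V * S * s) :+ (- (s * f * s)) <(tV)> (S * s)
  :+ (- (s * f)) <(sS)> s :+ (s * s * t * e * V) <(Ss)> 1 :+ V <(tsste)> V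
  :+ (-1) <(Vt)> (s * s * t * e * V)).
Qed.
End Converse.

(** * Three consecutive indices *)

Section Triple.
Context (T : pzRingType) (X Y : T).
Hypotheses (XC : forall u, X * u = u * X) (YX : Y * X = 1).

Lemma pair_tsf s S e t V f : bmw_pair X s S e t V f ->
  t * s * f = e * f - (e * t * e - e).
Proof.
move=> P; have P' := pair_swap XC YX P.
by rewrite -(pair_fsf XC YX P) (pair_ete XC YX P'); non_commutative_ring.
Qed.

Lemma centralV u : Y * u = u * Y.
Proof.
apply: (mulXI YX); have XY : X * Y = 1 by rewrite XC.
lincomb (1 <(XY)> u :+ (- u) <(XY)> 1 :+ (-1) <(XC u)> Y).
Qed.

Lemma pair_Ce s S e t V f : bmw_pair X s S e t V f ->
  (e * t * e - e) * e = (Y + Y - 1) * (e * t * e - e).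
Proof.
move=> P; have ee := skein_ee XC YX (pair_l P).
lincomb ((e * t - 1) <(ee)> 1 :+ (-1) <(centralV (e * t))> (e + e)).
Qed.

Lemma far_comm s S e t : skein X s S e -> s * t = t * s -> e * t = t * e.
Proof.
move=> [sS Ss sum se] c; apply: (mulXI YX).
lincomb ((-1) <(sum)> t :+ t <(sum)> 1 :+ (-1) <(XC t)> (1 + e) :+ 1 <(c)> 1
  :+ (- S) <(c)> S :+ 1 <(Ss)> (t * S) :+ (- (S * t)) <(sS)> 1).
Qed.

Section FarIndices.
Context (s1 S1 e1 s2 S2 e2 s3 S3 e3 : T).
Hypotheses (P12 : bmw_pair X s1 S1 e1 s2 S2 e2).
Hypotheses (P23 : bmw_pair X s2 S2 e2 s3 S3 e3).
Hypotheses (c13 : s1 * s3 = s3 * s1).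
Let p := e2 * s1 * e2 - e2.
Let q := e2 * s3 * e2 - e2.

Let E12 : e1 * s2 * e1 = e1 + p.
Proof. by rewrite /p (pair_fsf XC YX P12) addrC subrK. Qed.

Let E32 : e3 * s2 * e3 = e3 + q.
Proof. by rewrite /q -(pair_fsf XC YX P23) addrC subrK. Qed.

Let far13 : e1 * s3 = s3 * e1.
Proof. exact: (far_comm (pair_l P12) c13). Qed.

Lemma far_idem : e1 * e3 = e3 * e1.
Proof. by rewrite (far_comm (pair_r P23) (esym far13)). Qed.

(** [e1 s3 s2 e3 e1] is read as [s3 (e1 s2 e1) e3] and as [e1 (s3 s2 e3) e1]; the second reading
    uses [pair_tsf], then [pair_efe]. *)
Lemma triple_spe : s3 * p * e3 = (Y + Y) * p * e3 - e1 * q * e1.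
Proof.
have F12 := pair_efe XC YX P12; rewrite -(pair_fsf XC YX P12) -/p in F12.
have se := skein_se (pair_r P23); have sse := pair_tsf P23; rewrite -/q in sse.
lincomb ((- s3) <(E12)> e3 :+ (-1) <(far13)> (s2 * e1 * e3)
  :+ (e1 * s3 * s2) <(far_idem)> 1 :+ e1 <(sse)> e1 :+ (- (e1 * e2)) <(far_idem)> 1
  :+ 1 <(F12)> e3 :+ 1 <(far13)> e3 :+ (- e1) <(se)> 1).
Qed.

(** In [e1 e3 s2 e3 e1] either of the commuting pairs [e1], [e3] can be taken as the inner one, and
    [e1 e3 e1 = e3 e1 e3]. *)
Lemma triple_eqe : e1 * q * e1 = e3 * p * e3.
Proof.
have ee1 := skein_ee XC YX (pair_l P12); have ee3 := skein_ee XC YX (pair_r P23).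
lincomb ((- e1) <(E32)> e1 :+ e3 <(E12)> e3 :+ 1 <(far_idem)> (s2 * e3 * e1 - e3)
  :+ (- (e3 * e1 * s2) + e1) <(far_idem)> 1 :+ (-1) <(ee1)> e3 :+ e1 <(ee3)> 1
  :+ (-1) <(centralV e1)> (e3 + e3)).
Qed.
End FarIndices.

Section Triple.
(** [X + 2] is the rescaled form of x + 2a; [H] stands for 1/2. *)
Context (Z H : T) (ZX : Z * (X + 1 + 1) = 1) (H2 : H * (1 + 1) = 1).

Lemma triple_left s1 S1 e1 s2 S2 e2 s3 S3 e3 :
  bmw_pair X s1 S1 e1 s2 S2 e2 -> bmw_pair X s2 S2 e2 s3 S3 e3 ->
  s1 * s3 = s3 * s1 ->
  s3 * (e2 * s1 * e2 - e2) * e3 = (e2 * s1 * e2 - e2) * e3.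
Proof.
move=> P12 P23 c13; have A := triple_spe P12 P23 c13.
have cV : S1 * S3 = S3 * S1.
  case: P12 P23 => [[sS Ss _ _] _ _ _] [_ [tV Vt _ _] _ _].
  lincomb ((S1 * S3) <(c13)> (S3 * S1) :+ (- (S1 * S3 * s1)) <(tV)> S1
    :+ (- (S1 * S3)) <(sS)> 1 :+ S1 <(Vt)> (s1 * S3 * S1) :+ 1 <(Ss)> (S3 * S1)).
have := triple_spe (pair_inv XC YX P12) (pair_inv XC YX P23) cV.
(* By [pair_eVe], inverting the generators changes neither [p] nor [q], so [triple_spe] for the
   inverses has the same right-hand side. *)
have -> : e2 * S1 * e2 - e2 = e2 * s1 * e2 - e2.
  by rewrite (pair_eVe XC YX (pair_swap XC YX P12)) addrC addKr.
have -> : e2 * S3 * e2 - e2 = e2 * s3 * e2 - e2.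
  by rewrite (pair_eVe XC YX P23) addrC addKr.
have W := triple_eqe P12 P23 c13; rewrite W in A *.
set p := e2 * s1 * e2 - e2 in A W * => B.
have sum := skein_sum (pair_r P23).
have XY : X * Y = 1 by rewrite XC.
(* The sum of [A] and [B] is [(X + 2) e3 p e3 = (4 Y - X) p e3], and
   [4 Y - X = (X + 2) (2 Y - 1)]. *)
have {}W : e3 * p * e3 = (Y + Y - 1) * p * e3.
  lincomb ((-1) <(ZX)> (e3 * p * e3 - (Y + Y - 1) * p * e3) :+ (- Z) <(sum)> (p * e3)
    :+ Z <(A)> 1 :+ Z <(B)> 1 :+ (- Z) <(XY)> (p * e3 + p * e3)).
lincomb (1 <(A)> 1 :+ (-1) <(W)> 1).
Qed.

(** Substitute [s3 s2 e3 = e2 e3 - q], then [s2 s1 e2 = e1 e2 - p]. By [triple_left] for the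
    exchanged indices [s1] fixes [q e1], and so does [s2]; finally [p e1 = (2 Y - 1) p]. *)
Lemma triple_long s1 S1 e1 s2 S2 e2 s3 S3 e3 :
  bmw_pair X s1 S1 e1 s2 S2 e2 -> bmw_pair X s2 S2 e2 s3 S3 e3 ->
  s1 * s3 = s3 * s1 ->
  s2 * s1 * s3 * s2 * e1 * e3
  = e1 * e3 + (e2 * s1 * e2 - e2) * e3 - (e2 * s3 * e2 - e2) * e1.
Proof.
move=> P12 P23 c13.
have N := triple_left (pair_swap XC YX P23) (pair_swap XC YX P12) (esym c13).
have ee := far_idem P12 P23 c13.
have F12 := pair_efe XC YX P12; rewrite -(pair_fsf XC YX P12) in F12.
have pe := pair_Ce P12; rewrite -(pair_fsf XC YX P12) in pe.
have sse := pair_tsf P12; rewrite -(pair_fsf XC YX P12) in sse.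
have sse3 := pair_tsf P23.
have sp := pair_sC (pair_swap XC YX P12); have sq := pair_sC P23.
set p := e2 * s1 * e2 - e2 in F12 pe sse sp *.
set q := e2 * s3 * e2 - e2 in N sse3 sq *.
lincomb ((s2 * s1 * s3 * s2) <(ee)> 1 :+ (s2 * s1) <(sse3)> e1 :+ (- s2) <(N)> 1
  :+ (-1) <(sq)> e1 :+ 1 <(sse)> (e3 * e1) :+ (- (e1 * e2)) <(ee)> 1
  :+ p <(ee)> 1 :+ 1 <(F12)> e3 :+ (-1) <(pe)> e3).
Qed.

(** Exchanging 1 and 3 preserves the left-hand side of [triple_long] but changes the sign of
    [p e3 - q e1]; divide by 2. *)
Lemma triple_pe s1 S1 e1 s2 S2 e2 s3 S3 e3 :
  bmw_pair X s1 S1 e1 s2 S2 e2 -> bmw_pair X s2 S2 e2 s3 S3 e3 ->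
  s1 * s3 = s3 * s1 ->
  (e2 * s1 * e2 - e2) * e3 = (e2 * s3 * e2 - e2) * e1.
Proof.
move=> P12 P23 c13; have L := triple_long P12 P23 c13.
have R := triple_long (pair_swap XC YX P23) (pair_swap XC YX P12) (esym c13).
have ee := far_idem P12 P23 c13.
set p := e2 * s1 * e2 - e2 in L R *; set q := e2 * s3 * e2 - e2 in L R *.
lincomb ((-1) <(H2)> (p * e3 - q * e1) :+ (- H) <(L)> 1 :+ H <(R)> 1
  :+ (H * s2) <(c13)> (s2 * e1 * e3) :+ (H * s2 * s3 * s1 * s2) <(ee)> 1
  :+ (- H) <(ee)> 1).
Qed.

(** In [e2 e1 e2 e3 e2] replace either [e2 e1 e2] by [e2 + 2 Y p] or [e2 e3 e2] by [e2 + 2 Y q], and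
    cancel [2 Y]. *)
Lemma triple_diff s1 S1 e1 s2 S2 e2 s3 S3 e3 :
  bmw_pair X s1 S1 e1 s2 S2 e2 -> bmw_pair X s2 S2 e2 s3 S3 e3 ->
  e2 * s1 * e2 - e2 - (e2 * s3 * e2 - e2)
  = (e2 * s1 * e2 - e2) * e3 * e2 - e2 * e1 * (e2 * s3 * e2 - e2).
Proof.
move=> P12 P23; have F12 := pair_efe XC YX (pair_swap XC YX P12).
have F23 := pair_efe XC YX P23; have XY : X * Y = 1 by rewrite XC.
set p := e2 * s1 * e2 - e2 in F12 *; set q := e2 * s3 * e2 - e2 in F23 *.
lincomb ((-1) <(H2)> (p - q - p * e3 * e2 + e2 * e1 * q)
  :+ (- H) <(XY)> ((1 + 1) * (p - q - p * e3 * e2 + e2 * e1 * q))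
  :+ (H * X) <(F12)> (e3 * e2 - 1)
  :+ (H * X * (1 - e2 * e1)) <(F23)> 1
  :+ (H * X) <(centralV (e2 * e1))> (q + q)).
Qed.
End Triple.
End Triple.

Section TripleConv.
Context (T : pzRingType) (X Y Z H : T).
Hypotheses (XC : forall u, X * u = u * X) (YX : Y * X = 1).
Hypotheses (ZC : forall u, Z * u = u * Z) (ZX : Z * (X + 1 + 1) = 1).
Hypotheses (H2 : H * (1 + 1) = 1).

Lemma triple_ep s1 S1 e1 s2 S2 e2 s3 S3 e3 :
  bmw_pair X s1 S1 e1 s2 S2 e2 -> bmw_pair X s2 S2 e2 s3 S3 e3 ->
  s1 * s3 = s3 * s1 ->
  e3 * (e2 * s1 * e2 - e2) = e1 * (e2 * s3 * e2 - e2).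
Proof.
move=> P12 P23 c13.
have XCc (u : T^c) : (X : T^c) * u = u * (X : T^c) by apply: esym (XC u).
have YXc : (Y : T^c) * (X : T^c) = 1 by have E : X * Y = 1 by rewrite XC.
have ZXc : (Z : T^c) * ((X : T^c) + 1 + 1) = 1.
  by have E : (X + 1 + 1) * Z = 1 by rewrite -ZC.
have H2c : (H : T^c) * (1 + 1) = 1.
  by have E : (1 + 1) * H = 1 by rewrite -[RHS]H2 mulrDl mulrDr mul1r mulr1.
have c13c : (s1 : T^c) * (s3 : T^c) = (s3 : T^c) * (s1 : T^c).
  by have E : s3 * s1 = s1 * s3 := esym c13.
have E := triple_pe XCc YXc ZXc H2c (pair_conv XC YX P12) (pair_conv XC YX P23) c13c.
have E' : e3 * (e2 * (s1 * e2) - e2) = e1 * (e2 * (s3 * e2) - e2) := E.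
by rewrite -!mulrA.
Qed.

(** [A] and [B] make the right-hand sides of [D] and [D'] equal, so [p - q = q - p]. *)
Lemma triple_eq s1 S1 e1 s2 S2 e2 s3 S3 e3 :
  bmw_pair X s1 S1 e1 s2 S2 e2 -> bmw_pair X s2 S2 e2 s3 S3 e3 ->
  s1 * s3 = s3 * s1 -> e2 * s1 * e2 - e2 = e2 * s3 * e2 - e2.
Proof.
move=> P12 P23 c13.
have A := triple_pe XC YX ZX H2 P12 P23 c13; have B := triple_ep P12 P23 c13.
have D := triple_diff XC YX H2 P12 P23.
have D' := triple_diff XC YX H2 (pair_swap XC YX P23) (pair_swap XC YX P12).
set p := e2 * s1 * e2 - e2 in A B D D' *; set q := e2 * s3 * e2 - e2 in A B D D' *.
lincomb ((-1) <(H2)> (p - q) :+ H <(D)> 1 :+ (- H) <(D')> 1 :+ H <(A)> e2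
  :+ (H * e2) <(B)> 1).
Qed.
End TripleConv.

(** * Undoing the normalization a = 1 *)

Section Scaling.
Context (T : pzRingType) (A X Y : T).
Hypotheses (AC : forall u, A * u = u * A) (XC : forall u, X * u = u * X).
Hypotheses (AA : A * A = 1) (YX : Y * X = 1).

Definition eig (s S : T) : T := A * (Y * (S + s) - 1).

Lemma scaleM u v : (A * u) * (A * v) = u * v.
Proof. by rewrite mulrA -(mulrA A u) -(AC u) mulrA AA mul1r. Qed.

Lemma scale_inj u v : A * u = A * v -> u = v.
Proof. by move=> /(congr1 ( *%R A)); rewrite !mulrA AA !mul1r. Qed.

Lemma scaleXC u : A * X * u = u * (A * X).
Proof. by rewrite -mulrA XC mulrA AC mulrA. Qed.

Lemma scaleYX : (A * Y) * (A * X) = 1.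
Proof. by rewrite scaleM. Qed.

Let XY : X * Y = 1. Proof. by rewrite XC. Qed.

Lemma skein_scale s S : s * S = 1 -> S * s = 1 ->
  (s - A) * (s * s - X * s + 1) = 0 ->
  skein (A * X) (A * s) (A * S) (A * eig s S).
Proof.
move=> sS Ss cub; split; rewrite ?scaleM //.
  rewrite /eig mulrA AA mul1r addrCA subrr addr0 -mulrA [X * _]mulrA XY mul1r.
  by rewrite addrC mulrDr.
(* The cubic relation multiplied by [S]; moreover [eig s S = A Y (S + s - X)]. *)
have sA : (s - A) * (S + s - X) = 0.
  lincomb (1 <(cub)> S :+ (- ((s - A) * (s - X))) <(sS)> 1).
rewrite /eig; set W := S + s in sA *; apply: (mulXI YX).
lincomb (1 <(XC s)> (A * (Y * W - 1)) :+ s <(XC A)> (Y * W - 1) :+ (s * A) <(XY)> W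
  :+ (-1) <(AC s)> (W - X) :+ (-1) <(XC A)> (A * (Y * W - 1))
  :+ (- A) <(XC A)> (Y * W - 1) :+ (- (A * A)) <(XY)> W :+ A <(sA)> 1).
Qed.

Lemma skein_unscale s S : skein (A * X) (A * s) (A * S) (A * eig s S) ->
  s * eig s S = A * eig s S.
Proof. by move=> h; rewrite -(skein_se h) scaleM. Qed.

(** The cubic terms are [V (s + S) V - s (t + V) s]; in [s + S = X (1 + A e)] and
    [t + V = X (1 + A f)] the terms 1 cancel the squares. *)
Lemma calR_rel s S t V : skein (A * X) (A * s) (A * S) (A * eig s S) ->
  skein (A * X) (A * t) (A * V) (A * eig t V) ->
  - (s * V * s) + V * s * V - s * t * s - X * V ^+ 2 + X * s ^+ 2 + V * S * V
  = X * (A * (V * eig s S * V - s * eig t V * s)).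
Proof.
move=> /skein_sum hs /skein_sum ht; set e := eig s S in hs *; set f := eig t V in ht *.
have {}hs : s + S = X * (1 + A * e).
  by apply: scale_inj; rewrite mulrDr hs mulrA.
have {}ht : t + V = X * (1 + A * f).
  by apply: scale_inj; rewrite mulrDr ht mulrA.
rewrite !expr2.
lincomb (V <(hs)> V :+ (- s) <(ht)> s :+ (-1) <(XC V)> ((1 + A * e) * V)
  :+ 1 <(XC s)> ((1 + A * f) * s) :+ (- X) <(AC V)> (e * V) :+ X <(AC s)> (f * s)).
Qed.

Lemma scale3 u v w : A * u * (A * v) * (A * w) = A * (u * v * w).
Proof. by rewrite scaleM mulrA -AC -mulrA. Qed.

(** Three rescaled factors leave one factor [A], so relations between products of three generators
    are insensitive to the scaling. *)
Lemma scale3_eq u v w u' v' w' :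
  A * u * (A * v) * (A * w) = A * u' * (A * v') * (A * w') <->
  u * v * w = u' * v' * w'.
Proof. by rewrite !scale3; split=> [/scale_inj|->]. Qed.

Lemma calR0 s S t V C : skein (A * X) (A * s) (A * S) (A * eig s S) ->
  skein (A * X) (A * t) (A * V) (A * eig t V) -> s * t * s = t * s * t ->
  eig s S * t * eig s S = eig s S + C -> eig s S * V * eig s S = eig s S + C ->
  s * C = A * C -> t * C = A * C ->
  - (s * V * s) + V * s * V - s * t * s - X * V ^+ 2 + X * s ^+ 2 + V * S * V = 0.
Proof.
move=> hs ht br ete eVe sC tC; rewrite (calR_rel hs ht).
suff -> : s * eig t V * s = V * eig s S * V by rewrite subrr !mulr0.
apply/scale3_eq; apply: (cross_rel (C := A * C) scaleXC scaleYX hs ht).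
- exact/scale3_eq.
- by rewrite scale3 ete mulrDr.
- by rewrite scale3 eVe mulrDr.
- by rewrite scaleM.
- by rewrite scaleM.
Qed.

Lemma calR0_pair s S t V : skein (A * X) (A * s) (A * S) (A * eig s S) ->
  skein (A * X) (A * t) (A * V) (A * eig t V) -> s * t * s = t * s * t ->
  - (s * V * s) + V * s * V - s * t * s - X * V ^+ 2 + X * s ^+ 2 + V * S * V = 0 ->
  bmw_pair (A * X) (A * s) (A * S) (A * eig s S) (A * t) (A * V) (A * eig t V).
Proof.
move=> hs ht br; rewrite (calR_rel hs ht) => h; split=> //; apply/scale3_eq => //.
apply/esym/subr0_eq/scale_inj; rewrite mulr0; apply: (mulXI YX).
by rewrite h mulr0.
Qed.

(** * One element C for all pairs of adjacent indices *)

Section Family.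
Context (Z H : T) (ZC : forall u, Z * u = u * Z).
Hypotheses (ZX : Z * (X + (A + A)) = 1) (H2 : H * (1 + 1) = 1).
Context (m : nat) (s S : 'I_m.+2 -> T).
Hypotheses (sS : forall i, s i * S i = 1) (Ss : forall i, S i * s i = 1).
Hypothesis cub : forall i, (s i - A) * (s i * s i - X * s i + 1) = 0.
Hypothesis br : forall i j : 'I_m.+2, j = i.+1 :> nat ->
  s i * s j * s i = s j * s i * s j.
Hypothesis sfar : forall i j : 'I_m.+2, (i.+1 < j)%N -> s i * s j = s j * s i.
Hypothesis rel : forall i j : 'I_m.+2, j = i.+1 :> nat ->
  - (s i * S j * s i) + S j * s i * S j - s i * s j * s i - X * S j ^+ 2
  + X * s i ^+ 2 + S j * S i * S j = 0.

Let e i := eig (s i) (S i).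
Let sk i : skein (A * X) (A * s i) (A * S i) (A * e i).
Proof. exact: skein_scale. Qed.

Let pairP (i j : 'I_m.+2) : j = i.+1 :> nat ->
  bmw_pair (A * X) (A * s i) (A * S i) (A * e i) (A * s j) (A * S j) (A * e j).
Proof. by move=> ij; apply: calR0_pair => //; [apply: br | apply: rel]. Qed.

Let c (i j : 'I_m.+2) := A * e i * (A * s j) * (A * e i) - A * e i.

(** [A X + 2 = A (X + 2 A)]. *)
Let ZX2 : Z * A * (A * X + 1 + 1) = 1.
Proof. lincomb (1 <(ZX)> 1 :+ Z <(AA)> X). Qed.

Let ZAC u : Z * A * u = u * (Z * A).
Proof. lincomb (Z <(AC u)> 1 :+ 1 <(ZC u)> A). Qed.

(** By induction: [pair_fsf] passes from (k, k+1) to (k+1, k), and [triple_eq] from there to (k+1,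
    k+2). *)
Let c_succ (k : nat) (i j : 'I_m.+2) : i = k :> nat -> j = k.+1 :> nat ->
  c i j = c ord0 (inord 1).
Proof.
elim: k i j => [|k IHk] i j ik jk.
  have -> : i = ord0 by apply: val_inj.
  by have -> : j = inord 1 by apply: val_inj; rewrite /= inordK.
have kP : (k < m.+2)%N by apply: ltnW; rewrite -ik ltn_ord.
have P := pairP (i := Ordinal kP) ik; have P' := pairP (i := i) (j := j).
rewrite -(IHk (Ordinal kP) i erefl ik) /c -(pair_fsf scaleXC scaleYX P); apply/esym.
apply: (triple_eq scaleXC scaleYX ZAC ZX2 H2 P (P' _)); first by rewrite ik.
by rewrite !scaleM; apply: sfar; rewrite /= jk.
Qed.

Lemma family_cross : exists C, [/\
  forall i j : 'I_m.+2, (j == i.+1 :> nat) || (i == j.+1 :> nat) ->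
    e i * s j * e i = e i + C /\ e i * S j * e i = e i + C,
  forall i, s i * C = A * C & forall i, C * s i = A * C].
Proof.
set c0 := c ord0 (inord 1).
have unscale i u : A * e i * (A * u) * (A * e i) - A * e i = c0 ->
    e i * u * e i = e i + A * c0.
  move=> h; apply: scale_inj; rewrite -scale3 mulrDr [A * (A * c0)]mulrA AA mul1r -h.
  by rewrite addrC subrK.
have adj (i j : 'I_m.+2) : j = i.+1 :> nat -> [/\ c i j = c0, c j i = c0,
    A * e i * (A * S j) * (A * e i) - A * e i = c0 &
    A * e j * (A * S i) * (A * e j) - A * e j = c0].
  move=> ij; have P := pairP ij; have P' := pair_swap scaleXC scaleYX P.
  have cij := c_succ erefl ij; have cji : c j i = c0.
    by rewrite -[RHS]cij [LHS](pair_fsf scaleXC scaleYX P).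
  split=> //; first by rewrite (pair_eVe scaleXC scaleYX P) addrC addKr.
  by rewrite (pair_eVe scaleXC scaleYX P') addrC addKr.
have adjC (i j : 'I_m.+2) : j = i.+1 :> nat ->
    [/\ A * s i * c0 = c0, c0 * (A * s i) = c0,
    A * s j * c0 = c0 & c0 * (A * s j) = c0].
  move=> ij; have P := pairP ij; have P' := pair_swap scaleXC scaleYX P.
  have [cij cji _ _] := adj _ _ ij; split.
  - by rewrite -cij (pair_sC P).
  - by rewrite -cij (pair_Cs scaleXC scaleYX P).
  - by rewrite -cji (pair_sC P').
  - by rewrite -cji (pair_Cs scaleXC scaleYX P').
have sc0 (i : 'I_m.+2) : A * s i * c0 = c0 /\ c0 * (A * s i) = c0.
  (* Index 0 is the left end of the pair (0, 1); any other index is the right end of a pair. *)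
  case: i => [[|i] iP].
    by have [|? ? _ _] := adjC (Ordinal iP) (inord 1); rewrite ?inordK.
  by have [|_ _ ? ?] := adjC (Ordinal (ltnW iP)) (Ordinal iP).
(* [c0] was computed from [A e]; returning to [e] multiplies it by [A]. *)
exists (A * c0); split=> [i j ij|i|i].
- have [? ?] : A * e i * (A * s j) * (A * e i) - A * e i = c0 /\
      A * e i * (A * S j) * (A * e i) - A * e i = c0.
    by case/orP: ij => /eqP /adj[].
  by split; apply: unscale.
- by rewrite !mulrA -(AC (s i)) (sc0 i).1 AA mul1r.
- lincomb (1 <(AC c0)> (s i) :+ 1 <((sc0 i).2)> 1 :+ (-1) <(AA)> c0).
Qed.
End Family.
End Scaling.

(** * Morphisms out of the presented algebras *)

(** A synonym of [B], on which the [K]-algebra structure through [f] does not clash with the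
    [L]-algebra structure. *)
Definition restr (K L : comPzRingType) (f : {rmorphism K -> L})
  (B : pzAlgType L) : Type := B.

Section RestrictionOfScalars.
Context (K L : comPzRingType) (f : {rmorphism K -> L}) (B : pzAlgType L).
Local Notation restr := (restr f B).

HB.instance Definition _ := GRing.PzRing.on restr.

Definition restr_in_alg : {rmorphism K -> restr} := @pz_in_alg L B \o f.

Fact restr_in_algC k (u : restr) : restr_in_alg k * u = u * restr_in_alg k.
Proof. exact: pz_in_algC. Qed.
HB.instance Definition _ := PzRing_isPzAlgebra.Build K restr restr_in_algC.
End RestrictionOfScalars.

(** * Evaluation on presented groups and free algebras *)

Section GroupEval.
Context (X : choiceType) (rel : seq (X * bool) -> seq (X * bool) -> Prop).
Context (T : pzRingType) (v vV : X -> T).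

(** [T] is an arbitrary ring, so the values of the inverse letters are separate data [vV]. *)
Definition word_val (w : seq (X * bool)) : T :=
  \prod_(l <- w) (if l.2 then vV l.1 else v l.1).

Hypotheses (vK : forall g, v g * vV g = 1) (Kv : forall g, vV g * v g = 1).
Hypothesis vrel : forall w w', rel w w' -> word_val w = word_val w'.

Lemma word_val_eq w w' : word_eq rel w w' -> word_val w = word_val w'.
Proof.
elim=> {w w'} // [w1 w2 w3 _ -> _ -> //|w1 w2 w1' w2' _ e1 _ e2|g b].
- by rewrite /word_val !big_cat -/(word_val w1) -/(word_val w2) e1 e2.
- by rewrite /word_val big_cons big_seq1 big_nil; case: b; rewrite /= ?vK ?Kv.
Qed.

Definition pg_val (z : presGroup rel) : T := word_val (repr z).

Lemma pg_val_word w : pg_val (pg_word rel w) = word_val w.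
Proof. exact/word_val_eq/repr_pg. Qed.

Lemma pg_val1 : pg_val 1%g = 1.
Proof. by rewrite pg_val_word /word_val big_nil. Qed.

Lemma pg_valM z z' : pg_val (z * z')%g = pg_val z * pg_val z'.
Proof.
elim/pgW: z => w; elim/pgW: z' => w'; rewrite [(_ * _)%g]pg_mulE !pg_val_word.
exact: big_cat.
Qed.

Lemma pg_val_gen g : pg_val (pg_gen rel g) = v g.
Proof. by rewrite pg_val_word /word_val big_seq1. Qed.

Lemma pg_val_genV g : pg_val (pg_gen rel g)^-1%g = vV g.
Proof.
rewrite -[LHS]mulr1 -(vK g) -(pg_val_gen g) mulrA -pg_valM mulVg pg_val1.
by rewrite mul1r.
Qed.
End GroupEval.

Section FreeEval.
Context (K : comPzRingType) (X : choiceType) (B : pzAlgType K) (v : X -> B).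

Definition fm_val (w : freeMonoid X) : B := \prod_(g <- w) v g.

Fact fm_val1 : fm_val 1%g = 1. Proof. exact: big_nil. Qed.
Fact fm_valM w w' : fm_val (w * w')%g = fm_val w * fm_val w'.
Proof. exact: big_cat. Qed.

Definition fa_lift : {pzalg freeAlg K X -> B} := ma_lift fm_val1 fm_valM.

Lemma fa_lift_gen g : fa_lift (fa_gen K g) = v g.
Proof. by apply: etrans (ma_lift_in _ _ _) _; apply: big_seq1. Qed.
End FreeEval.

(** * Morphisms are determined by scalars and generators *)

Section Extensionality.
Context (T : pzRingType).

(** Stated for ring morphisms, so as to compare composites that pass through several base rings. *)
Lemma ma_ext (K : comPzRingType) (M : monoidType)
    (f g : {rmorphism monAlg K M -> T}) :
  (forall k : K, f k%:K = g k%:K) -> (forall k : M, f (ma_in k) = g (ma_in k)) ->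
  f =1 g.
Proof.
move=> eK eM; elim/ma_ind=> [|u v eu ev|c k]; first by rewrite !rmorph0.
  by rewrite !rmorphD eu ev.
by rewrite ma_UE !rmorphM eK eM.
Qed.

Lemma tens_lK (K L : comPzRingType) (F : {rmorphism K -> L}) (E : pzAlgType K)
  (k : K) : tens_l F (k%:K : E) = (F k)%:K.
Proof.
rewrite /tens_l -[k%:K]mulr1 tensZ mulr1 -[F k in LHS]mulr1 -tensK tens1.
by rewrite mulr1.
Qed.

Lemma tensor_ext (K L : comPzRingType) (F : {rmorphism K -> L}) (E : pzAlgType K)
    (f g : {rmorphism tensor F E -> T}) :
  (forall k : L, f k%:K = g k%:K) ->
  (forall u : E, f (tens_l F u) = g (tens_l F u)) -> f =1 g.
Proof.
move=> eK eE; elim/rqW=> z.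
apply: (ma_ext (f := f \o rq (@tensor_rel K L F E))
               (g := g \o rq (@tensor_rel K L F E))) => [k|u /=].
  exact: eK.
by have := eE u; rewrite /tens_l /tens rmorph1 mul1r.
Qed.

Lemma fa_ext (K : comPzRingType) (X : choiceType)
    (f g : {rmorphism freeAlg K X -> T}) :
  (forall k : K, f k%:K = g k%:K) ->
  (forall x, f (fa_gen K x) = g (fa_gen K x)) -> f =1 g.
Proof.
move=> eK eX; apply: ma_ext => // w; elim: w => [|x w IHw].
  by rewrite -[ma_in _]/(1 : freeAlg K X) !rmorph1.
have -> : ma_in (x :: w : freeMonoid X) = fa_gen K x * ma_in (w : freeMonoid X).
  exact: (ma_inM K ([:: x] : freeMonoid X) w).
by rewrite !rmorphM eX IHw.
Qed.

Lemma pg_ext (K : comPzRingType) (X : choiceType)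
    (rel : seq (X * bool) -> seq (X * bool) -> Prop)
    (f g : {rmorphism monAlg K (presGroup rel) -> T}) :
  (forall k : K, f k%:K = g k%:K) ->
  (forall x, f (ma_in (pg_gen rel x)) = g (ma_in (pg_gen rel x))) -> f =1 g.
Proof.
move=> eK eX; apply: ma_ext => //; elim/pgW; elim=> [|[x b] w IHw].
  by rewrite -[ma_in _]/(1 : monAlg K (presGroup rel)) !rmorph1.
have -> : pg_word rel ((x, b) :: w) = (pg_word rel [:: (x, b)] * pg_word rel w)%g.
  by rewrite [RHS]pg_mulE.
rewrite ma_inM !rmorphM IHw; congr (_ * _).
case: b; last exact: eX.
have -> : pg_word rel [:: (x, true)] = (pg_gen rel x)^-1%g.
  by apply/esym/(@mulgI _ (pg_gen rel x)); rewrite mulgV [RHS]pg_mulE;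
     apply/esym/pg_wordP/word_eq_cancel.
(* The values at the inverse of a generator agree because inverses in [T] are unique. *)
set y := pg_gen rel x.
have inv (h : {rmorphism monAlg K (presGroup rel) -> T}) :
    h (ma_in y^-1%g) * h (ma_in y) = 1 /\ h (ma_in y) * h (ma_in y^-1%g) = 1.
  by rewrite -!rmorphM -!ma_inM mulVg mulgV ma_in1 rmorph1.
rewrite -[LHS]mulr1 -(inv g).2 -eX mulrA (inv f).1 mul1r //.
Qed.
End Extensionality.

Section Morph.
Context (K : comPzRingType) (E B : pzAlgType K) (f : {rmorphism E -> B}).
Hypothesis fK : forall k : K, f k%:K = k%:K.

Lemma hecke_morph (a b c : K) (s : E) s' : f s = s' ->
  f ((s - a%:K) * (s - b%:K) * (s - c%:K))
  = (s' - a%:K) * (s' - b%:K) * (s' - c%:K).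
Proof. by move=> <-; rewrite !rmorphM !rmorphB !fK. Qed.

Lemma calR_morph (x y : K) (s t S V : E) s' t' S' V' :
  f s = s' -> f t = t' -> f S = S' -> f V = V' ->
  f (- (y%:K * (s * V * s)) + (y ^+ 2)%:K * (V * s * V)
  - s * t * s - (x * y ^+ 2)%:K * V ^+ 2 + x%:K * s ^+ 2
  + (y ^+ 3)%:K * (V * S * V))
  = - (y%:K * (s' * V' * s')) + (y ^+ 2)%:K * (V' * s' * V')
  - s' * t' * s' - (x * y ^+ 2)%:K * V' ^+ 2 + x%:K * s' ^+ 2
  + (y ^+ 3)%:K * (V' * S' * V').
Proof.
move=> <- <- <- <-.
by rewrite !(rmorphD f, rmorphB f, rmorphN f) !(rmorphXn f, rmorphM f) !fK.
Qed.
End Morph.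

(** * Universal property of the quotient of the braid group algebra *)

Section BmwLift.
Context (n : nat) (B : pzAlgType ringR) (s S : 'I_n.-1 -> B).
Hypotheses (sS : forall i, s i * S i = 1) (Ss : forall i, S i * s i = 1).
Hypothesis br : forall i j : 'I_n.-1, j = i.+1 :> nat ->
  s i * s j * s i = s j * s i * s j.
Hypothesis sfar : forall i j : 'I_n.-1, far i j -> s i * s j = s j * s i.
Hypothesis cub : forall i, (s i - Ra%:K) * (s i - Rb%:K) * (s i - Rc%:K) = 0.
Hypothesis rel : forall i j : 'I_n.-1, j = i.+1 :> nat ->
  - (Ry%:K * (s i * S j * s i)) + (Ry ^+ 2)%:K * (S j * s i * S j)
  - s i * s j * s i - (Rx * Ry ^+ 2)%:K * S j ^+ 2 + Rx%:K * s i ^+ 2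
  + (Ry ^+ 3)%:K * (S j * S i * S j) = 0.

Lemma braid_rel_val w w' : braid_rel w w' -> word_val s S w = word_val s S w'.
Proof.
case=> {w w'} i j h; rewrite /word_val !big_cons !big_nil /= !mulr1.
  by rewrite !mulrA br.
exact: sfar.
Qed.

Let val : braid n -> B := @pg_val _ (@braid_rel n) _ s S.
Let val1 : val 1%g = 1 := pg_val1 sS Ss braid_rel_val.
Let valM : forall g h, val (g * h)%g = val g * val h := pg_valM sS Ss braid_rel_val.

Definition RB_lift : {pzalg RB n -> B} := ma_lift val1 valM.

Lemma RB_lift_gen i : RB_lift (ma_in (artin i)) = s i.
Proof. exact: etrans (ma_lift_in _ _ _) (pg_val_gen sS Ss braid_rel_val i). Qed.

Lemma RB_lift_genV i : RB_lift (ma_in (artin i)^-1%g) = S i.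
Proof. exact: etrans (ma_lift_in _ _ _) (pg_val_genV sS Ss braid_rel_val i). Qed.

Fact RB_lift_rel u : hecke_rel u -> RB_lift u = 0.
Proof.
have K k : RB_lift k%:K = k%:K by apply: (pzalg_morphK (s := RB_lift)).
by case=> i; apply: etrans (hecke_morph K _ _ _ (RB_lift_gen i)) (cub i).
Qed.

Definition hecke_lift : {pzalg hecke n -> B} := rq_lift RB_lift_rel.

Lemma hecke_lift_gen i : hecke_lift (hecke_of (artin i)) = s i.
Proof. exact: etrans (rq_liftE _ _) (RB_lift_gen i). Qed.

Lemma hecke_lift_genV i : hecke_lift (hecke_of (artin i)^-1%g) = S i.
Proof. exact: etrans (rq_liftE _ _) (RB_lift_genV i). Qed.

Fact hecke_lift_rel u : bmw_rel u -> hecke_lift u = 0.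
Proof.
have K k : hecke_lift k%:K = k%:K by apply: (pzalg_morphK (s := hecke_lift)).
case=> i j ij; apply: etrans (rel ij).
exact: (calR_morph K _ _ (hecke_lift_gen i) (hecke_lift_gen j)
  (hecke_lift_genV i) (hecke_lift_genV j)).
Qed.

Definition bmw_lift : {pzalg bmw n -> B} := rq_lift hecke_lift_rel.

Lemma bmw_lift_gen i : bmw_lift (rq (@bmw_rel n) (hecke_of (artin i))) = s i.
Proof. exact: etrans (rq_liftE _ _) (hecke_lift_gen i). Qed.
End BmwLift.

(** * Universal property of F_n *)

Section FalgLift.
Context (n : nat) (B : pzAlgType ringA) (s S : 'I_n.-1 -> B) (C : B).
Let e i : B := Aa%:K * (AxV%:K * (S i + s i) - 1).
Hypotheses (Ss : forall i, S i * s i = 1).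
Hypothesis br : forall i j : 'I_n.-1, j = i.+1 :> nat ->
  s i * s j * s i = s j * s i * s j.
Hypothesis sfar : forall i j : 'I_n.-1, far i j -> s i * s j = s j * s i.
Hypothesis cub : forall i, (s i - Aa%:K) * (s i ^+ 2 - Ax%:K * s i + 1) = 0.
Hypothesis se : forall i, s i * e i = Aa%:K * e i.
Hypothesis ese : forall i j : 'I_n.-1, adjacent i j ->
  e i * s j * e i = e i + C /\ e i * S j * e i = e i + C.
Hypothesis sC : forall i, s i * C = Aa%:K * C.
Hypothesis Cs : forall i, C * s i = Aa%:K * C.

Definition F_val (g : F_gen n) : B :=
  match g with inl (inl i) => s i | inl (inr i) => e i | inr _ => C end.

Definition F_free_lift : {pzalg F_free n -> B} := fa_lift F_val.
Local Notation L := F_free_lift.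

Let Ls i : L (F_s i) = s i. Proof. exact: fa_lift_gen. Qed.
Let Le i : L (F_e i) = e i. Proof. exact: fa_lift_gen. Qed.
Let LC : L (F_C n) = C. Proof. exact: fa_lift_gen. Qed.
Let LK k : L k%:K = k%:K. Proof. exact: (pzalg_morphK (s := L)). Qed.
Let LM u v u' v' : L u = u' -> L v = v' -> L (u * v) = u' * v'.
Proof. by move=> <- <-; apply: rmorphM. Qed.
Let LD u v u' v' : L u = u' -> L v = v' -> L (u + v) = u' + v'.
Proof. by move=> <- <-; apply: rmorphD. Qed.
Let LN u u' : L u = u' -> L (- u) = - u'.
Proof. by move=> <-; apply: rmorphN. Qed.
Let Leq u v u' v' : L u = u' -> L v = v' -> u' = v' -> L u = L v.
Proof. by move=> -> ->. Qed.
Let L1 : L 1 = 1. Proof. exact: rmorph1. Qed.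

Let LsV i : L (F_sV i) = S i.
Proof.
(* The polynomial coding the inverse in [F_sV] is a right inverse of [s i], hence equals its left
   inverse [S i]. *)
have [sV _] := cubic_inv Aa2 (cub i).
have -> : L (F_sV i)
    = Aa%:K * (s i ^+ 2 - (Ax + Aa)%:K * s i + (1 + Aa * Ax)%:K).
  exact: LM (LK _) (LD (LD (LM (Ls i) (Ls i)) (LN (LM (LK _) (Ls i)))) (LK _)).
by rewrite -[LHS]mul1r -(Ss i) -mulrA sV mulr1.
Qed.

Fact F_free_lift_rel w : F_ideal w -> L w = 0.
Proof.
case=> u [v [h ->]]; suff E : L u = L v.
  by apply: etrans (rmorphB L u v) _; apply/eqP; rewrite subr_eq0; apply/eqP.
case: h => {u v} [i j ij|i j ij|i|i|i|i j ij|i j ij|i|i].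
- exact: Leq (LM (LM (Ls i) (Ls j)) (Ls i)) (LM (LM (Ls j) (Ls i)) (Ls j)) (br ij).
- exact: Leq (LM (Ls i) (Ls j)) (LM (Ls j) (Ls i)) (sfar ij).
- apply: Leq (rmorph0 L) (cub i).
  exact: LM (LD (Ls i) (LN (LK _)))
    (LD (LD (LM (Ls i) (Ls i)) (LN (LM (LK _) (Ls i)))) L1).
- apply: Leq (Le i) _ (erefl _).
  exact: LM (LK _) (LD (LM (LK _) (LD (LsV i) (Ls i))) (LN L1)).
- exact: Leq (LM (Ls i) (Le i)) (LM (LK _) (Le i)) (se i).
- exact: Leq (LM (LM (Le i) (Ls j)) (Le i)) (LD (Le i) LC) (ese ij).1.
- exact: Leq (LM (LM (Le i) (LsV j)) (Le i)) (LD (Le i) LC) (ese ij).2.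
- exact: Leq (LM (Ls i) LC) (LM LC (Ls i)) (etrans (sC i) (esym (Cs i))).
- exact: Leq (LM LC (Ls i)) (LM (LK _) LC) (Cs i).
Qed.

Definition Falg_lift : {pzalg Falg n -> B} := rq_lift F_free_lift_rel.

Lemma Falg_lift_s i : Falg_lift (rq (@F_ideal n) (F_s i)) = s i.
Proof. exact: etrans (rq_liftE _ _) (Ls i). Qed.

End FalgLift.

Section FalgExt.
Context (n : nat) (T : pzRingType) (f g : {rmorphism Falg n -> T}).
Hypothesis eK : forall k : ringA, f k%:K = g k%:K.
Hypothesis eS : forall i : 'I_n.-1,
  f (rq (@F_ideal n) (F_s i)) = g (rq (@F_ideal n) (F_s i)).

Let q : {rmorphism F_free n -> Falg n} := rq (@F_ideal n).
Let fq : {rmorphism F_free n -> T} := f \o q.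
Let gq : {rmorphism F_free n -> T} := g \o q.
Let agree u := fq u = gq u.

Let agM u v : agree u -> agree v -> agree (u * v).
Proof.
by move=> eu ev; apply: etrans (rmorphM fq u v) _; rewrite eu ev -(rmorphM gq).
Qed.
Let agD u v : agree u -> agree v -> agree (u + v).
Proof.
by move=> eu ev; apply: etrans (rmorphD fq u v) _; rewrite eu ev -(rmorphD gq).
Qed.
Let agN u : agree u -> agree (- u).
Proof. by move=> eu; apply: etrans (rmorphN fq u) _; rewrite eu -(rmorphN gq). Qed.
Let ag1 : agree 1. Proof. exact: etrans (rmorph1 fq) (esym (rmorph1 gq)). Qed.
Let agK k : agree k%:K. Proof. exact: eK. Qed.
Let ags i : agree (F_s i). Proof. exact: eS. Qed.

Let ag_rel u v : F_rel u v -> agree v -> agree u.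
Proof. by move=> h; rewrite /agree /fq /gq /= (Falg_rel h). Qed.

Let agsV i : agree (F_sV i).
Proof.
apply: agM (agK _) (agD (agD _ (agN (agM (agK _) (ags i)))) (agK _)).
exact: agM (ags i) (ags i).
Qed.

Let age i : agree (F_e i).
Proof.
apply: ag_rel (F_rel_e i) _.
exact: agM (agK _) (agD (agM (agK _) (agD (agsV i) (ags i))) (agN ag1)).
Qed.

(** [e_i] is an expression in [s_i], and [C = e_1 s_2 e_1 - e_1], where two generators must exist:
    hence 3 <= n. *)
Lemma Falg_ext : (3 <= n)%N -> f =1 g.
Proof.
move=> hn; elim/rqW; apply: (fa_ext (f := fq) (g := gq)) => // -[[i|i]|[]].
- exact: ags.
- exact: age.
have lt0 : (0 < n.-1)%N by rewrite -ltnS prednK // (leq_trans _ hn).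
have lt1 : (1 < n.-1)%N by rewrite -ltnS prednK // (leq_trans _ hn).
have h : F_rel (F_e (Ordinal lt0) * F_s (Ordinal lt1) * F_e (Ordinal lt0))
  (F_e (Ordinal lt0) + F_C n) by apply: F_rel_ese; rewrite /adjacent eqxx.
have : agree (F_e (Ordinal lt0) + F_C n).
  have := agM (agM (age (Ordinal lt0)) (ags (Ordinal lt1))) (age (Ordinal lt0)).
  by rewrite /agree /fq /gq /= (Falg_rel h).
move=> /(agD (agN (age (Ordinal lt0)))).
by rewrite addKr.
Qed.
End FalgExt.

Lemma bmw_ext (n : nat) (T : pzRingType) (f g : {rmorphism bmw n -> T}) :
  (forall k : ringR, f k%:K = g k%:K) ->
  (forall i : 'I_n.-1, f (rq (@bmw_rel n) (hecke_of (artin i)))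
    = g (rq (@bmw_rel n) (hecke_of (artin i)))) -> f =1 g.
Proof.
move=> eK eS; elim/rqW; elim/rqW.
pose q : {rmorphism RB n -> bmw n} := rq (@bmw_rel n) \o rq (@hecke_rel n).
pose fq : {rmorphism RB n -> T} := f \o q.
pose gq : {rmorphism RB n -> T} := g \o q.
exact: (pg_ext (f := fq) (g := gq) eK eS).
Qed.

(** * Inverting a map after extension of scalars *)

Section TensorInverse.
Context (M N : comPzRingType) (G : {rmorphism M -> N}) (E E' : pzAlgType M).
Context (phi : {pzalg E -> E'}) (psi : {pzalg E' -> restr G (tensor G E)}).

(** The [N]-linear extension of [psi] is the inverse; both composites are compared with the identity
    on the images of [E] and [E']. *)
Lemma tensor_map_bij : (forall u, psi (phi u) = tens_l G u) ->
  (forall v, tensor_map G phi (psi v) = tens_l G v) ->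
  bijective (tensor_map G phi).
Proof.
move=> psiK phiK.
pose psi1 : {rmorphism E' -> tensor G E} := psi.
have psi1K k : psi1 k%:K = (G k)%:K by apply: (pzalg_morphK (s := psi)).
pose psi2 : {pzalg tensor G E' -> tensor G E} := tensor_lift psi1K.
have mapK k : tensor_map G phi k%:K = k%:K.
  exact: (pzalg_morphK (s := tensor_map G phi)).
have psi2K k : psi2 k%:K = k%:K by apply: (pzalg_morphK (s := psi2)).
have psi2E v : psi2 (tens_l G v) = psi v.
  by apply: etrans (tensor_liftE psi1K _ _) _; rewrite rmorph1 mul1r.
have mapE u : tensor_map G phi (tens_l G u) = tens_l G (phi u).
  exact: tensor_mapE.
exists psi2.
  apply: (tensor_ext (f := psi2 \o tensor_map G phi) (g := idfun)) => [k|u].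
    exact: etrans (congr1 psi2 (mapK k)) (psi2K k).
  exact: etrans (congr1 psi2 (mapE u)) (etrans (psi2E _) (psiK u)).
apply: (tensor_ext (f := tensor_map G phi \o psi2) (g := idfun)) => [k|v].
  exact: etrans (congr1 (tensor_map G phi) (psi2K k)) (mapK k).
exact: etrans (congr1 (tensor_map G phi) (psi2E v)) (phiK v).
Qed.
End TensorInverse.

(** * Transport of the relations along ring morphisms, and the case y = 1 *)

Section Transport.
Context (E T : pzRingType) (f : {rmorphism E -> T}).

Lemma calR0_morph (X s t S V : E) X' : f X = X' ->
  - (s * V * s) + V * s * V - s * t * s - X * V ^+ 2 + X * s ^+ 2 + V * S * V = 0 ->
  - (f s * f V * f s) + f V * f s * f V - f s * f t * f s - X' * f V ^+ 2
  + X' * f s ^+ 2 + f V * f S * f V = 0.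
Proof.
move=> <- /(congr1 f); rewrite rmorph0 => <-.
by rewrite !(rmorphD f, rmorphB f, rmorphN f) !(rmorphXn f, rmorphM f).
Qed.

Lemma morphM3 (u v w : E) : f (u * v * w) = f u * f v * f w.
Proof. by rewrite !rmorphM. Qed.

Lemma eig_morph (A Y s S : E) :
  f (eig A Y s S) = eig (f A) (f Y) (f s) (f S).
Proof. by rewrite /eig !(rmorphM, rmorphB, rmorphD) rmorph1. Qed.

Lemma inv_transport (u v : E) : u * v = 1 -> f u * f v = 1.
Proof. by move=> uv; rewrite -rmorphM uv rmorph1. Qed.

Lemma comm_transport (u v : E) : u * v = v * u -> f u * f v = f v * f u.
Proof. by move=> uv; rewrite -!rmorphM uv. Qed.

Lemma braid_transport (u v : E) : u * v * u = v * u * v ->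
  f u * f v * f u = f v * f u * f v.
Proof. by move=> uv; rewrite -!rmorphM uv. Qed.

Lemma cubic_transport (a x : E) a' x' s s' : f a = a' -> f x = x' -> f s = s' ->
  (s' - a') * (s' * s' - x' * s' + 1) = f ((s - a) * (s ^+ 2 - x * s + 1)).
Proof.
move=> <- <- <-.
by rewrite !(rmorphM, rmorphB, rmorphXn, rmorphD, rmorph1).
Qed.
End Transport.

Section CalRUnit.
Context (K : comPzRingType) (B : pzAlgType K) (x y : K) (y1 : y%:K = 1 :> B).

Lemma calR_unit (s t S V : B) :
  - (y%:K * (s * V * s)) + (y ^+ 2)%:K * (V * s * V)
  - s * t * s - (x * y ^+ 2)%:K * V ^+ 2 + x%:K * s ^+ 2
  + (y ^+ 3)%:K * (V * S * V)
  = - (s * V * s) + V * s * V - s * t * s - x%:K * V ^+ 2 + x%:K * s ^+ 2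
    + V * S * V.
Proof. by rewrite rmorphM !rmorphXn y1 !expr1n !mul1r mulr1. Qed.

(** Where y acts as 1, [(s - b) (s - c)] is [s s - x s + 1]: the cubic relation of the Hecke algebra
    becomes that of F_n. *)
Lemma cubic_factor (a b c : K) (s : B) : (b + c)%:K = x%:K :> B ->
  (b * c)%:K = y%:K :> B ->
  (s - a%:K) * (s - b%:K) * (s - c%:K)
  = (s - a%:K) * (s * s - x%:K * s + 1).
Proof.
rewrite y1 => <-; rewrite rmorphM rmorphD => bc.
lincomb (((s - a%:K)) <(bc)> 1 :+ (s - a%:K) <(pz_in_algC c s)> 1).
Qed.
End CalRUnit.

(** * Relations satisfied in the two presented algebras *)

Section FalgRelations.
Context (n : nat).
Let q : {rmorphism F_free n -> Falg n} := rq (@F_ideal n).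
Let s i := q (F_s i).
Let S i := q (F_sV i).
Let A : Falg n := Aa%:K.
Let X : Falg n := Ax%:K.
Let Y : Falg n := AxV%:K.

Lemma Falg_s_braid (i j : 'I_n.-1) : j = i.+1 :> nat ->
  s i * s j * s i = s j * s i * s j.
Proof.
move=> ij; apply: etrans (esym (morphM3 q _ _ _)) _.
exact: etrans (Falg_rel (F_rel_braid ij)) (morphM3 q _ _ _).
Qed.

Lemma Falg_s_far (i j : 'I_n.-1) : far i j -> s i * s j = s j * s i.
Proof.
move=> ij; apply: etrans (esym (rmorphM q _ _)) _.
exact: etrans (Falg_rel (F_rel_comm ij)) (rmorphM q _ _).
Qed.

Let AA : A * A = 1.
Proof. by rewrite -rmorphM -expr2 Aa2 rmorph1. Qed.
Let YX : Y * X = 1.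
Proof. by rewrite -rmorphM mulrC AxK rmorph1. Qed.

Let eE i : q (F_e i) = eig A Y (s i) (S i).
Proof. exact: etrans (Falg_rel (F_rel_e i)) (eig_morph q _ _ _ _). Qed.

Lemma Falg_calR (i j : 'I_n.-1) : j = i.+1 :> nat ->
  - (s i * S j * s i) + S j * s i * S j - s i * s j * s i - X * S j ^+ 2
  + X * s i ^+ 2 + S j * S i * S j = 0.
Proof.
move=> ij; have adj : adjacent i j by rewrite /adjacent ij eqxx.
have sk k : skein (A * X) (A * s k) (A * S k) (A * eig A Y (s k) (S k)).
  exact: (@skein_scale _ A X Y (pz_in_algC Aa) (pz_in_algC Ax) AA YX _ _
    (Falg_mulsV k) (Falg_mulVs k) (Falg_cubic k)).
have sC k : s k * q (F_C n) = A * q (F_C n).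
  have h := etrans (Falg_rel (F_rel_sC k)) (Falg_rel (F_rel_Cs k)).
  exact: etrans (esym (rmorphM q _ _)) (etrans h (rmorphM q _ _)).
have ete : eig A Y (s i) (S i) * s j * eig A Y (s i) (S i)
    = eig A Y (s i) (S i) + q (F_C n).
  rewrite -eE; apply: etrans (esym (morphM3 q _ _ _)) _.
  exact: etrans (Falg_rel (F_rel_ese adj)) (rmorphD q _ _).
have eVe : eig A Y (s i) (S i) * S j * eig A Y (s i) (S i)
    = eig A Y (s i) (S i) + q (F_C n).
  rewrite -eE; apply: etrans (esym (morphM3 q _ _ _)) _.
  exact: etrans (Falg_rel (F_rel_esVe adj)) (rmorphD q _ _).
exact: (@calR0 _ A X Y (pz_in_algC Aa) (pz_in_algC Ax) AA YX _ _ _ _ _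
  (sk i) (sk j) (Falg_s_braid ij) ete eVe (sC i) (sC j)).
Qed.
End FalgRelations.

Lemma restr_in_alg1 (K L : comPzRingType) (f : {rmorphism K -> L})
  (B : pzAlgType L) (k : K) : f k = 1 -> k%:K = 1 :> restr f B.
Proof.
by move=> fk; apply: etrans (congr1 (@pz_in_alg L B) fk) (rmorph1 pz_in_alg).
Qed.

Section GroupAlgebraMorph.
Context (K : comPzRingType) (G : groupType) (T : pzRingType).
Context (f : {rmorphism monAlg K G -> T}).

Lemma ma_morphM (g h : G) : f (ma_in (g * h)%g) = f (ma_in g) * f (ma_in h).
Proof. by rewrite ma_inM rmorphM. Qed.

Lemma ma_morphV (g : G) : f (ma_in g) * f (ma_in g^-1%g) = 1.
Proof. by rewrite -ma_morphM mulgV rmorph1. Qed.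

Lemma ma_morphVl (g : G) : f (ma_in g^-1%g) * f (ma_in g) = 1.
Proof. by rewrite -ma_morphM mulVg rmorph1. Qed.

Lemma ma_morph_comm (g h : G) : (g * h = h * g)%g ->
  f (ma_in g) * f (ma_in h) = f (ma_in h) * f (ma_in g).
Proof. by move=> gh; rewrite -!ma_morphM gh. Qed.

Lemma ma_morph_braid (g h : G) : (g * h * g = h * g * h)%g ->
  f (ma_in g) * f (ma_in h) * f (ma_in g)
  = f (ma_in h) * f (ma_in g) * f (ma_in h).
Proof. by move=> gh; rewrite -!ma_morphM gh. Qed.
End GroupAlgebraMorph.

Section BmwRelations.
Context (n : nat).
Let q : {rmorphism RB n -> bmw n} := rq (@bmw_rel n) \o rq (@hecke_rel n).
Definition bmw_s (i : 'I_n.-1) : bmw n := rq (@bmw_rel n) (hecke_of (artin i)).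
Definition bmw_sV (i : 'I_n.-1) : bmw n :=
  rq (@bmw_rel n) (hecke_of (artin i)^-1%g).
Local Notation s := bmw_s.
Local Notation S := bmw_sV.

Let qK k : q k%:K = k%:K. Proof. by []. Qed.

Lemma bmw_mulsV i : s i * S i = 1.
Proof. exact: (ma_morphV q (artin i)). Qed.

Lemma bmw_mulVs i : S i * s i = 1.
Proof. exact: (ma_morphVl q (artin i)). Qed.

Lemma bmw_s_far (i j : 'I_n.-1) : far i j -> s i * s j = s j * s i.
Proof.
move=> ij; apply: (ma_morph_comm q (g := artin i) (h := artin j)).
rewrite [LHS]pg_mulE [RHS]pg_mulE; apply/pg_wordP/word_eq_rel.
exact: braid_rel2 ij.
Qed.

Lemma bmw_s_braid (i j : 'I_n.-1) : j = i.+1 :> nat ->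
  s i * s j * s i = s j * s i * s j.
Proof.
move=> ij; apply: (ma_morph_braid q (g := artin i) (h := artin j)).
have E k l : (artin k * artin l * artin k)%g
    = pg_word (@braid_rel n) [:: (k, false); (l, false); (k, false)].
  by rewrite [(artin k * artin l)%g]pg_mulE [LHS]pg_mulE.
by rewrite !E; apply/pg_wordP/word_eq_rel/braid_rel3.
Qed.

Lemma bmw_cubic i : (s i - Ra%:K) * (s i - Rb%:K) * (s i - Rc%:K) = 0.
Proof.
apply: etrans (esym (hecke_morph qK Ra Rb Rc (erefl (s i)))) _.
apply: etrans (congr1 (rq (@bmw_rel n)) (rq_rel (hecke_rel_cubic i))) _.
exact: rmorph0.
Qed.

Lemma bmw_calR (i j : 'I_n.-1) : j = i.+1 :> nat ->
  - (Ry%:K * (s i * S j * s i)) + (Ry ^+ 2)%:K * (S j * s i * S j)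
  - s i * s j * s i - (Rx * Ry ^+ 2)%:K * S j ^+ 2 + Rx%:K * s i ^+ 2
  + (Ry ^+ 3)%:K * (S j * S i * S j) = 0.
Proof.
move=> ij; apply: etrans (rq_rel (bmw_rel_calR ij)); apply: esym.
exact: (calR_morph (rq_morphK (@bmw_rel n)) Rx Ry (erefl (s i)) (erefl (s j))
  (erefl (S i)) (erefl (S j))).
Qed.
End BmwRelations.

Lemma Sddy : R_to_Sdd Ry = 1.
Proof.
have h := rq_rel Sdd_rel_y.
have h' : S_to_Sdd (R_to_S Ry) - S_to_Sdd 1 = 0.
  exact: etrans (esym (rmorphB S_to_Sdd _ _)) h.
exact: etrans (subr0_eq h') (rmorph1 S_to_Sdd).
Qed.

(** * The morphism from BMW_n to F_n *)

Section BmwToFalg.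
Context (n : nat) (L : comPzRingType) (T : pzAlgType L).
Context (f : {rmorphism ringR -> L}) (tau : {rmorphism Falg n -> T}).
Hypotheses (tau_a : tau Aa%:K = (f Ra)%:K) (tau_x : tau Ax%:K = (f Rx)%:K).
Hypothesis f_y : f Ry = 1.

Local Notation B := (restr f T).
Let s (i : 'I_n.-1) : B := tau (rq (@F_ideal n) (F_s i)).
Let S (i : 'I_n.-1) : B := tau (rq (@F_ideal n) (F_sV i)).

Let y1 : Ry%:K = 1 :> B. Proof. exact: restr_in_alg1. Qed.

Let sS i : s i * S i = 1. Proof. exact: (inv_transport tau (Falg_mulsV i)). Qed.
Let Ss i : S i * s i = 1. Proof. exact: (inv_transport tau (Falg_mulVs i)). Qed.

Let br (i j : 'I_n.-1) : j = i.+1 :> nat -> s i * s j * s i = s j * s i * s j.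
Proof. by move=> ij; apply: (braid_transport tau (Falg_s_braid ij)). Qed.

Let sfar (i j : 'I_n.-1) : far i j -> s i * s j = s j * s i.
Proof. by move=> ij; apply: (comm_transport tau (Falg_s_far ij)). Qed.

Let cub i : (s i - Ra%:K) * (s i - Rb%:K) * (s i - Rc%:K) = 0.
Proof.
apply: etrans (cubic_factor y1 Ra (s i) (erefl (Rx%:K : B)) (erefl (Ry%:K : B))) _.
apply: etrans (cubic_transport tau_a tau_x (erefl _)) _.
exact: etrans (congr1 tau (Falg_cubic i)) (rmorph0 tau).
Qed.

Let rel (i j : 'I_n.-1) : j = i.+1 :> nat ->
  - (Ry%:K * (s i * S j * s i)) + (Ry ^+ 2)%:K * (S j * s i * S j)
  - s i * s j * s i - (Rx * Ry ^+ 2)%:K * S j ^+ 2 + Rx%:K * s i ^+ 2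
  + (Ry ^+ 3)%:K * (S j * S i * S j) = 0.
Proof.
move=> ij; apply: etrans (calR_unit Rx y1 _ _ _ _) _.
exact: (calR0_morph tau_x (Falg_calR ij)).
Qed.

Definition bmw_to_Falg : {pzalg bmw n -> B} := bmw_lift sS Ss br sfar cub rel.

Lemma bmw_to_Falg_s i :
  bmw_to_Falg (bmw_s i) = tau (rq (@F_ideal n) (F_s i)).
Proof. exact: bmw_lift_gen. Qed.
End BmwToFalg.

Section Forward.
Context (n : nat).
Let tau : {rmorphism Falg n -> Falgdd n} := @tens_l _ _ A_to_Sdd (Falg n).
Let tauK k : tau k%:K = (A_to_Sdd k)%:K. Proof. exact: tens_lK. Qed.
Let tau_a : tau Aa%:K = (R_to_Sdd Ra)%:K.
Proof. exact: etrans (tauK _) (congr1 _ A_to_Sdd_a). Qed.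
Let tau_x : tau Ax%:K = (R_to_Sdd Rx)%:K.
Proof. exact: etrans (tauK _) (congr1 _ A_to_Sdd_x). Qed.

Let g : {pzalg bmw n -> restr R_to_Sdd (Falgdd n)} :=
  bmw_to_Falg tau_a tau_x Sddy.
Let g0 : {rmorphism bmw n -> Falgdd n} := g.

Let gK k : g0 k%:K = (R_to_Sdd k)%:K.
Proof. exact: (pzalg_morphK (s := g)). Qed.

Definition bmwdd_to_Falgdd : {pzalg bmwdd n -> Falgdd n} := tensor_lift gK.

Lemma bmwdd_to_Falgdd_s i : bmwdd_to_Falgdd (bmwdd_s i) = Falgdd_s i.
Proof.
apply: etrans (tensor_liftE gK _ _) _; rewrite rmorph1 mul1r.
exact: bmw_to_Falg_s.
Qed.
End Forward.

(** * The morphism from F_n to the localized BMW_n *)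

Section UnitTransport.
Context (K : comPzRingType) (E : pzAlgType K) (T : pzRingType).
Context (f : {rmorphism E -> T}) (y : K) (fy : f y%:K = 1).

Lemma calR_transport (x : K) x' (s t S V : E) : f x%:K = x' ->
  - (y%:K * (s * V * s)) + (y ^+ 2)%:K * (V * s * V)
  - s * t * s - (x * y ^+ 2)%:K * V ^+ 2 + x%:K * s ^+ 2
  + (y ^+ 3)%:K * (V * S * V) = 0 ->
  - (f s * f V * f s) + f V * f s * f V - f s * f t * f s
  - x' * f V ^+ 2 + x' * f s ^+ 2 + f V * f S * f V = 0.
Proof.
move=> <- /(congr1 f); rewrite rmorph0 => <-.
rewrite !(rmorphD f, rmorphB f, rmorphN f) !(rmorphXn f, rmorphM f).
by rewrite !(rmorphXn, rmorphM) /= fy !expr1n !mul1r mulr1.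
Qed.

Lemma hecke_transport (a b c : K) a' x' (s : E) :
  f a%:K = a' -> f (b + c)%:K = x' -> b * c = y ->
  (s - a%:K) * (s - b%:K) * (s - c%:K) = 0 ->
  (f s - a') * (f s * f s - x' * f s + 1) = 0.
Proof.
move=> <- <- bcy /(congr1 f); rewrite rmorph0 => <-.
have bc : f b%:K * f c%:K = 1 by rewrite -!rmorphM bcy.
have cs : f c%:K * f s = f s * f c%:K by rewrite -!rmorphM pz_in_algC.
rewrite !(rmorphM f, rmorphB f, rmorphD) /=.
lincomb ((- (f s - f a%:K)) <(bc)> 1 :+ (- (f s - f a%:K)) <(cs)> 1).
Qed.
End UnitTransport.

(** [z] and [h] invert x + 2a and 2, as [family_cross] requires; that lemma provides the image of
    C. *)
Lemma Falg_to_bmw (n : nat) (L : comPzRingType) (T : pzAlgType L)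
    (f : {rmorphism ringA -> L}) (sigma : {rmorphism bmw n -> T}) (z h : L) :
  (3 <= n)%N -> sigma Ra%:K = (f Aa)%:K -> sigma Rx%:K = (f Ax)%:K ->
  sigma Ry%:K = 1 -> z * (f Ax + (f Aa + f Aa)) = 1 -> h * (1 + 1) = 1 ->
  exists psi : {pzalg Falg n -> restr f T},
    forall i, psi (rq (@F_ideal n) (F_s i)) = sigma (bmw_s i).
Proof.
(* For [n = m.+3] the generators are indexed by ['I_m.+2], as in [family_cross]. *)
case: n sigma => [|[|[|m]]] // sigma _ sa sx sy zx h2.
pose A : T := (f Aa)%:K; pose X : T := (f Ax)%:K; pose Y : T := (f AxV)%:K.
pose s (i : 'I_m.+2) := sigma (@bmw_s m.+3 i).
pose S (i : 'I_m.+2) := sigma (@bmw_sV m.+3 i).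
pose K : {rmorphism L -> T} := pz_in_alg.
have AA : A * A = 1 := inv_transport K (inv_transport f (Aa2 : Aa * Aa = 1)).
have xV : AxV * Ax = 1 := etrans (mulrC AxV Ax) AxK.
have YX : Y * X = 1 := inv_transport K (inv_transport f xV).
have ZX : z%:K * (X + (A + A)) = 1 :> T.
  by rewrite -!(rmorphD K) -(rmorphM K) zx rmorph1.
have H2 : h%:K * (1 + 1) = 1 :> T.
  by rewrite -(rmorph1 K) -(rmorphD K) -(rmorphM K) h2.
have sS i : s i * S i = 1 by apply: (inv_transport sigma (@bmw_mulsV m.+3 i)).
have Ss i : S i * s i = 1 by apply: (inv_transport sigma (@bmw_mulVs m.+3 i)).
have cub i : (s i - A) * (s i * s i - X * s i + 1) = 0.
  exact: (hecke_transport sy sa sx (erefl Ry) (@bmw_cubic m.+3 i)).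
have br (i j : 'I_m.+2) : j = i.+1 :> nat -> s i * s j * s i = s j * s i * s j.
  by move=> ij; apply: (braid_transport sigma (@bmw_s_braid m.+3 i j ij)).
have sfar (i j : 'I_m.+2) : far i j -> s i * s j = s j * s i.
  by move=> ij; apply: (comm_transport sigma (@bmw_s_far m.+3 i j ij)).
have rel (i j : 'I_m.+2) : j = i.+1 :> nat ->
  - (s i * S j * s i) + S j * s i * S j - s i * s j * s i - X * S j ^+ 2
  + X * s i ^+ 2 + S j * S i * S j = 0.
  by move=> ij; apply: (calR_transport sy sx (@bmw_calR m.+3 i j ij)).
have sfar' (i j : 'I_m.+2) : (i.+1 < j)%N -> s i * s j = s j * s i.
  by move=> ij; apply: sfar; rewrite /far ij.
have AC u : A * u = u * A := pz_in_algC (f Aa) u.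
have XC u : X * u = u * X := pz_in_algC (f Ax) u.
have [C [ese sC Cs]] := family_cross AC XC AA YX (pz_in_algC z) ZX H2 sS Ss cub
  br sfar' rel.
have se i : s i * eig A Y (s i) (S i) = A * eig A Y (s i) (S i).
  have sk := skein_scale AC XC AA YX (sS i) (Ss i) (cub i).
  exact (@skein_unscale T A X Y AC AA (s i) (S i) sk).
pose B := restr f T.
by exists (@Falg_lift m.+3 B s S C Ss br sfar cub se ese sC Cs); apply: Falg_lift_s.
Qed.

(** Serves to bring 1/2 into the base ring. *)
Definition rat_to_Sdd : {rmorphism rat -> ringSdd} :=
  R_to_Sdd \o (loc_in (poly_a * poly_b * poly_c) : {rmorphism _ -> ringR})
  \o (@mpolyC 3 rat : {rmorphism rat -> polyQ3}).

Lemma rat_half (T : pzRingType) (f : {rmorphism rat -> T}) : f 2^-1 * (1 + 1) = 1.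
Proof. by rewrite -(rmorph1 f) -(rmorphD f) -(rmorphM f). Qed.

Lemma tens_l2K (K L M : comPzRingType) (f : {rmorphism K -> L})
    (g : {rmorphism L -> M}) (E : pzAlgType K) (k : K) :
  tens_l g (tens_l f (k%:K : E)) = (g (f k))%:K.
Proof. by rewrite !tens_lK. Qed.

Lemma morph_add2 (U V : pzRingType) (g : {rmorphism U -> V}) (u v : U) :
  g (u + 2%:R * v) = g u + (g v + g v).
Proof. by rewrite mulr_natl mulr2n !rmorphD. Qed.

Definition A_to_loc : {rmorphism ringA -> ringSddloc} := Sdd_to_loc \o A_to_Sdd.

Lemma Falg_to_bmwloc (n : nat) : (3 <= n)%N ->
  exists psi : {pzalg Falg n -> restr A_to_loc (tensor Sdd_to_loc (bmwdd n))},
    forall i, psi (rq (@F_ideal n) (F_s i)) = tens_l Sdd_to_loc (bmwdd_s i).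
Proof.
move=> hn.
pose f := A_to_loc.
pose sigma : {rmorphism bmw n -> tensor Sdd_to_loc (bmwdd n)} :=
  @tens_l _ _ Sdd_to_loc (bmwdd n) \o @tens_l _ _ R_to_Sdd (bmw n).
have sK k : sigma k%:K = (Sdd_to_loc (R_to_Sdd k))%:K by apply: tens_l2K.
have sa : sigma Ra%:K = (f Aa)%:K.
  exact: etrans (sK _) (congr1 (fun u => (Sdd_to_loc u)%:K) (esym A_to_Sdd_a)).
have sx : sigma Rx%:K = (f Ax)%:K.
  exact: etrans (sK _) (congr1 (fun u => (Sdd_to_loc u)%:K) (esym A_to_Sdd_x)).
have sy : sigma Ry%:K = 1.
  apply: etrans (sK _) _; apply: etrans (congr1 (fun u => (Sdd_to_loc u)%:K) Sddy) _.
  exact: etrans (congr1 pz_in_alg (rmorph1 Sdd_to_loc)) (rmorph1 pz_in_alg).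
have fa : f Aa = Sdd_to_loc Sdda := congr1 Sdd_to_loc A_to_Sdd_a.
have fx : f Ax = Sdd_to_loc Sddx := congr1 Sdd_to_loc A_to_Sdd_x.
have zx : loc_inv (Sddx + 2%:R * Sdda) * (f Ax + (f Aa + f Aa)) = 1.
  have E : f Ax + (f Aa + f Aa) = Sdd_to_loc (Sddx + 2%:R * Sdda).
    by apply: etrans (esym (morph_add2 Sdd_to_loc _ _)); rewrite fa fx.
  apply: etrans (mulrC _ _) _.
  exact: etrans (congr1 (fun u => u * loc_inv _) E) (loc_inK _).
have h2 : Sdd_to_loc (rat_to_Sdd 2^-1) * (1 + 1) = 1.
  exact: (rat_half (Sdd_to_loc \o rat_to_Sdd)).
exact: Falg_to_bmw hn sa sx sy zx h2.
Qed.

(** * The two morphisms are mutually inverse after localization *)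

Section Inverse.
Context (n : nat) (hn : (3 <= n)%N).
Local Notation BL := (tensor Sdd_to_loc (bmwdd n)).
Context (psi0 : {pzalg Falg n -> restr A_to_loc BL}).
Hypothesis psi0_s : forall i,
  psi0 (rq (@F_ideal n) (F_s i)) = tens_l Sdd_to_loc (bmwdd_s i).

(** The same map as [psi0]: A acts on the target through [ringSdd], so it extends to [Falgdd n]. *)
Let g : {rmorphism Falg n -> restr Sdd_to_loc BL} :=
  (psi0 : {rmorphism Falg n -> restr A_to_loc BL}).
Let gK k : g k%:K = (A_to_Sdd k)%:K.
Proof. exact: (pzalg_morphK (s := psi0)). Qed.

Let psi : {pzalg Falgdd n -> restr Sdd_to_loc BL} := tensor_lift gK.
Let psiK k : psi k%:K = (Sdd_to_loc k)%:K :> BL.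
Proof. exact: (pzalg_morphK (s := psi)). Qed.
Let psiE u : psi (tens_l A_to_Sdd u) = g u.
Proof. by apply: etrans (tensor_liftE gK _ _) _; rewrite rmorph1 mul1r. Qed.

Local Notation phi := (bmwdd_to_Falgdd n).
Let phiK k : phi k%:K = k%:K. Proof. exact: (pzalg_morphK (s := phi)). Qed.

Let phi_s i : phi (tens_l R_to_Sdd (bmw_s i))
  = tens_l A_to_Sdd (rq (@F_ideal n) (F_s i)).
Proof. exact: bmwdd_to_Falgdd_s. Qed.

Lemma psi_phi (u : bmwdd n) : psi (phi u) = tens_l Sdd_to_loc u.
Proof.
pose c : {rmorphism bmwdd n -> BL} := (psi : {rmorphism _ -> _}) \o phi.
pose t : {rmorphism bmwdd n -> BL} := @tens_l _ _ Sdd_to_loc (bmwdd n).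
suff : c =1 t by apply.
have ctK k : c k%:K = t k%:K.
  by apply: etrans (congr1 psi (phiK k)) (etrans (psiK k) (esym (tens_lK _ _ _))).
apply: tensor_ext => // {u}.
pose r : {rmorphism bmw n -> bmwdd n} := @tens_l _ _ R_to_Sdd (bmw n).
have rK k : r k%:K = (R_to_Sdd k)%:K := tens_lK _ _ _.
apply: (bmw_ext (f := c \o r) (g := t \o r)) => [k|i].
  exact: etrans (congr1 c (rK k)) (etrans (ctK _) (congr1 t (esym (rK k)))).
exact: etrans (congr1 psi (phi_s i)) (etrans (psiE _) (psi0_s i)).
Qed.

Lemma phi_psi (v : Falgdd n) :
  tensor_map Sdd_to_loc phi (psi v) = tens_l Sdd_to_loc v.
Proof.
pose m := tensor_map Sdd_to_loc phi.
pose mr : {rmorphism BL -> tensor Sdd_to_loc (Falgdd n)} := m.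
pose c : {rmorphism Falgdd n -> tensor Sdd_to_loc (Falgdd n)} :=
  mr \o (psi : {rmorphism Falgdd n -> BL}).
pose t : {rmorphism Falgdd n -> tensor Sdd_to_loc (Falgdd n)} :=
  @tens_l _ _ Sdd_to_loc (Falgdd n).
suff : c =1 t by apply.
have mK k : m k%:K = k%:K by apply: (pzalg_morphK (s := m)).
have ctK k : c k%:K = t k%:K.
  exact: etrans (congr1 m (psiK k)) (etrans (mK _) (esym (tens_lK _ _ _))).
apply: tensor_ext => // {v}.
pose r : {rmorphism Falg n -> Falgdd n} := @tens_l _ _ A_to_Sdd (Falg n).
have rK k : r k%:K = (A_to_Sdd k)%:K := tens_lK _ _ _.
(* Only scalars and the [s_i] remain to be compared; they determine the values at the [e_i] and at
   C. *)
apply: (Falg_ext (f := c \o r) (g := t \o r)) => // [k|i].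
  exact: etrans (congr1 c (rK k)) (etrans (ctK _) (congr1 t (esym (rK k)))).
apply: etrans (congr1 m (etrans (psiE _) (psi0_s i))) _.
apply: etrans (tensor_mapE _ _ _ _) _.
exact: (congr1 (fun w => tens Sdd_to_loc w 1) (bmwdd_to_Falgdd_s i)).
Qed.

Lemma tensor_map_phi_bij : bijective (tensor_map Sdd_to_loc phi).
Proof. exact: tensor_map_bij psi_phi phi_psi. Qed.
End Inverse.

Theorem theorem6p8 (n : nat) (hn : (3 <= n)%N) :
  exists phi : {pzalg bmwdd n -> Falgdd n},
    (forall i : 'I_n.-1, phi (bmwdd_s i) = Falgdd_s i) /\
    bijective (tensor_map Sdd_to_loc phi).
Proof.
(* The morphism lives over [ringSdd]; its inverse, from [Falg_to_bmwloc], lives over the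
   localization. *)
exists (bmwdd_to_Falgdd n); split; first exact: bmwdd_to_Falgdd_s.
have [psi0 psi0_s] := Falg_to_bmwloc hn.
exact: tensor_map_phi_bij hn psi0 psi0_s.
Qed.
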